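(* Let $N\in\mathbb{N}$ and $s>-1$. Define \[ \tilde\pi_N^{(s)}(x)=\frac{(p^{-1-s};p^{-1})_N^2(p^{-1};p^{-1})_N^2}{(p^{-1-s};p^{-1})_{2N}(p^{-1};p^{-1})_x(p^{-1-s};p^{-1})_x(p^{-1};p^{-1})_{N-x}^2}\,p^{-(N-x)^2},\quad 0\le x\le N. \] Then $\tilde\pi_N^{(s)}$ is a probability measure on $\{0,1,\dots,N\}$. Moreover, for every $\mathbf{k}\in\Delta_N$, setting $x_i=\sum_{j=i}^\infty l_j(\mathbf{k})$ for $i\ge0$ and $y_i=N-\sum_{j=-i}^\infty l_j(\mathbf{k})$ for $i\ge0$ (so $y_0=N-x_0$), \[ \mathsf{m}_N^{(s)}(\mathbf{k})=\tilde\pi_N^{(s)}(x_0)\prod_{i=0}^\infty\mathsf{P}^{(s)}(x_i,x_{i+1})\prod_{i=0}^\infty\mathsf{P}^{(0)}(y_i,y_{i+1}). \] Equivalently, a $\mathbf{k}$ with law $\mathsf{m}_N^{(s)}$ can be sampled by drawing $\sum_{i\ge0}l_i(\mathbf{k})$ from $\tilde\pi_N^{(s)}$, then running from it a Markov chain with kernel $\mathsf{P}^{(s)}$ to produce $\sum_{i\ge1}l_i(\mathbf{k}),\sum_{i\ge2}l_i(\mathbf{k}),\dots$, and (independently given the starting point) running from $N-\sum_{i\ge0}l_i(\mathbf{k})$ a Markov chain with kernel $\mathsf{P}^{(0)}$ to produce $N-\sum_{i\ge-1}l_i(\mathbf{k}),N-\sum_{i\ge-2}l_i(\mathbf{k}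),\dots$.
   Context: $(\alpha;q)_N=\prod_{j=0}^{N-1}(1-\alpha q^j)$. $\mathsf{vol}$ is the Haar measure on $\mathrm{Mat}(N,\mathbb{Q}_p)$ with $\mathsf{vol}(\mathrm{Mat}(N,\mathbb{Z}_p))=1$. Every $\mathbf{Z}\in\mathrm{Mat}(N,\mathbb{Q}_p)$ is $\mathbf{B}\,\mathrm{diag}(p^{-k_1},\dots,p^{-k_N})\,\mathbf{C}$ with $\mathbf{B},\mathbf{C}\in\mathrm{GL}(N,\mathbb{Z}_p)$ and unique $k_1\ge\dots\ge k_N\ge-\infty$ ($p^{-(-\infty)}=0$); $\mathsf{Sing}_N(\mathbf{Z})=(k_1,\dots,k_N)\in\Delta_N=\{(k_1,\dots,k_N)\in(\mathbb{Z}\cup\{-\infty\})^N:k_1\ge\dots\ge k_N\}$. $l_i(\mathbf{k})=\#\{j:k_j=i\}$ for $i\in\mathbb{Z}\cup\{-\infty\}$; sums $\sum_{j=m}^\infty$ run over integers $j\ge m$. $\gamma(\mathbf{Z})=\prod_{j:k_j>0}p^{k_j}$ ($=1$ if none); $d\mathsf{M}_N^{(s)}(\mathbf{Z})=\frac{(p^{-1-s};p^{-1})_N^2}{(p^{-1-s};p^{-1})_{2N}}\gamma(\mathbf{Z})^{-s-2N}d\mathsf{vol}(\mathbf{Z})$ is a probability measure and $\mathsf{m}_N^{(s)}=(\mathsf{Sing}_N)_*\mathsf{M}_N^{(s)}$. For $s>-1$, $\mathsf{P}^{(s)}(x_1,x_2)=\frac{p^{-x_2^2-sx_2}(p^{-1};p^{-1})_{x_1}(p^{-1-s};p^{-1})_{x_1}}{(p^{-1};p^{-1})_{x_2}(p^{-1};p^{-1})_{x_1-x_2}(p^{-1-s};p^{-1})_{x_2}}\mathbf{1}(0\le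 x_2\le x_1)$ for $x_1,x_2\in\mathbb{Z}_+$; it is a Markov kernel on $\mathbb{Z}_+$. *)

(* Defs.v *)
From HB Require Import structures.
From mathcomp Require Import all_boot all_order all_algebra.
From mathcomp Require Import all_classical all_reals all_analysis.

Set Implicit Arguments.
Unset Strict Implicit.
Unset Printing Implicit Defensive.

Import Order.TTheory GRing.Theory Num.Theory.
Local Open Scope classical_set_scope.
Local Open Scope ring_scope.

(* An element of Q_p is its (unique) p-adic digit expansion                  *)
(*   x = sum_{n in Z} d_n p^n,  0 <= d_n < p,  d_n = 0 for n << 0.           *)
(* [base p] is [maxn p 2], which equals p for the prime p of the theorem     *)
(* (it only serves to make the construction total in p).                    *)

Definition base (p : nat) : nat := maxn p 2.

Lemma base_gt0 p : (0 < base p)%N.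
Proof. by rewrite /base (leq_trans _ (leq_maxr _ _)). Qed.

Record qp (p : nat) := Qp {
  qdig : int -> nat ;
  qdig_lt : forall n, (qdig n < base p)%N ;
  qdig_bdd : exists M : int, forall n : int, n < M -> qdig n = 0%N }.

HB.instance Definition _ p := gen_eqMixin (qp p).
HB.instance Definition _ p := gen_choiceMixin (qp p).

Section Qp.
Variable p : nat.

Lemma qzero_lt (n : int) : ((fun _ : int => 0%N) n < base p)%N.
Proof. exact: base_gt0. Qed.
Lemma qzero_bdd : exists M : int, forall n : int, n < M -> (fun _ : int => 0%N) n = 0%N.
Proof. by exists 0. Qed.

Definition qzero : qp p := Qp qzero_lt qzero_bdd.

Lemma mk_lt (f : int -> nat) n : (f n %% base p < base p)%N.
Proof. exact: ltn_pmod (base_gt0 p). Qed.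
Lemma mk_bdd (f : int -> nat) :
  (exists M : int, forall n : int, n < M -> f n = 0%N) ->
  exists M : int, forall n : int, n < M -> (f n %% base p)%N = 0%N.
Proof. case=> M h; exists M => n /h ->; exact: mod0n. Qed.

(* smart constructor: the element with digit sequence f (f is only used when
   it is a genuine digit sequence, bounded below; otherwise 0) *)
Definition qmk (f : int -> nat) : qp p :=
  match pselect (exists M : int, forall n : int, n < M -> f n = 0%N) with
  | left h => Qp (mk_lt f) (mk_bdd h)
  | right _ => qzero
  end.

Definition qlow (x : qp p) : int := projT1 (cid (qdig_bdd x)).

Definition qtrunc (x : qp p) (m : int) : rat :=
  let L := qlow x in
  \sum_(0 <= i < (if L < m then `|m - L|%N else 0%N))
     (qdig x (L + i%:Z))%:R * ((base p)%:R : rat) ^ (L + i%:Z).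

Definition rdigit (r : rat) (n : int) : nat :=
  `|(Num.floor (r / ((base p)%:R : rat) ^ n) %% (base p)%:Z)%Z|%N.

Definition qadd (x y : qp p) : qp p :=
  qmk (fun n => rdigit (qtrunc x (n + 1) + qtrunc y (n + 1)) n).

(* multiplication in Q_p: the digit n of x*y is that of a_K(x) a_K(y) for
   K large enough, namely K = |n| + 1 - min(qlow x,0) - min(qlow y,0) *)
Definition qmul (x y : qp p) : qp p :=
  qmk (fun n =>
    let K := (`|n|%N)%:Z + 1 - Num.min (qlow x) 0 - Num.min (qlow y) 0 in
    rdigit (qtrunc x K * qtrunc y K) n).

Definition qpow (m : int) : qp p := qmk (fun n => (n == m) : nat).
Definition qone : qp p := qpow 0.

Definition qint (x : qp p) : Prop := forall n : int, n < 0 -> qdig x n = 0%N.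

End Qp.

Definition MatQp (p N : nat) := 'M[qp p]_N.
HB.instance Definition _ p N := gen_eqMixin (MatQp p N).
HB.instance Definition _ p N := gen_choiceMixin (MatQp p N).
HB.instance Definition _ p N :=
  isPointed.Build (MatQp p N) (\matrix_(i, j) qzero p).

Section Mat.
Variables p N : nat.

Definition madd (A B : MatQp p N) : MatQp p N :=
  \matrix_(i, j) qadd (A i j) (B i j).

Definition qsum (s : seq (qp p)) : qp p := foldr (@qadd p) (qzero p) s.

Definition mmul (A B : MatQp p N) : MatQp p N :=
  \matrix_(i, k) qsum [seq qmul (A i j) (B j k) | j <- enum 'I_N].

Definition mone : MatQp p N :=
  \matrix_(i, j) if i == j then qone p else qzero p.

Definition mint (A : MatQp p N) : Prop := forall i j, qint (A i j).

Definition inGL (B : MatQp p N) : Prop :=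
  mint B /\ exists B', mint B' /\ mmul B B' = mone /\ mmul B' B = mone.

(* elements of Z u {-oo}: None stands for -oo *)
Definition oge (a b : option int) : bool :=
  match b, a with
  | None, _ => true
  | Some _, None => false
  | Some y, Some x => y <= x
  end.

Definition inDelta (k : 'I_N -> option int) : Prop :=
  forall i j : 'I_N, (i <= j)%N -> oge (k i) (k j).

Definition sdiag (k : 'I_N -> option int) : MatQp p N :=
  \matrix_(i, j) if i == j then
                   (if k i is Some m then qpow p (- m) else qzero p)
                 else qzero p.

Definition is_sing (Z : MatQp p N) (k : 'I_N -> option int) : Prop :=
  exists B C, inGL B /\ inGL C /\ Z = mmul (mmul B (sdiag k)) C.

(* Sing_N(Z): the (unique) k in Delta_N with is_sing Z k *)
Definition Sing (Z : MatQp p N) : 'I_N -> option int :=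
  match pselect (exists k, inDelta k /\ is_sing Z k) with
  | left h => projT1 (cid h)
  | right _ => fun _ => None
  end.

(* Balls A + p^m Mat(N, Z_p); they generate the Borel sigma-algebra *)
Definition mball (A : MatQp p N) (m : int) : set (MatQp p N) :=
  [set Z | forall i j (n : int), n < m -> qdig (Z i j) n = qdig (A i j) n].

Definition mballs : set (set (MatQp p N)) :=
  [set S | exists A m, S = mball A m].

Definition MatQpMeas := g_sigma_algebraType mballs.

Definition MatZp : set MatQpMeas := [set Z | mint Z].

Definition mtranslate (A : MatQp p N) : MatQpMeas -> MatQpMeas := madd A.

End Mat.

Section Meas.
Variables (R : realType) (p N : nat).

Definition qpoch (a q : R) (n : nat) : R := \prod_(j < n) (1 - a * q ^+ j).

Definition pinv : R := (p%:R)^-1.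
Definition pa (s : R) : R := (p%:R) `^ (-1 - s).

Definition gammak (k : 'I_N -> option int) : R :=
  \prod_(j < N) (if k j is Some m then (if 0 < m then (p%:R) ^+ `|m|%N else 1)
                 else 1).

Definition Mconst (s : R) : R := qpoch (pa s) pinv N ^+ 2 / qpoch (pa s) pinv (2 * N)%N.

Definition MN (vol : set (MatQpMeas p N) -> \bar R) (s : R)
    (A : set (MatQpMeas p N)) : \bar R :=
  ((Mconst s)%:E * \int[vol]_(Z in A) ((gammak (Sing Z)) `^ (- s - 2 * N%:R))%:E)%E.

Definition mN (vol : set (MatQpMeas p N) -> \bar R) (s : R)
    (k : 'I_N -> option int) : \bar R :=
  MN vol s [set Z | Sing Z = k].

Definition pitilde (s : R) (x : nat) : R :=
  (qpoch (pa s) pinv N ^+ 2 * qpoch pinv pinv N ^+ 2)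
  / (qpoch (pa s) pinv (2 * N)%N * qpoch pinv pinv x * qpoch (pa s) pinv x
     * qpoch pinv pinv (N - x)%N ^+ 2)
  * pinv ^+ ((N - x) ^ 2)%N.

Definition Pker (s : R) (x1 x2 : nat) : R :=
  if (x2 <= x1)%N then
    (p%:R) `^ (- (x2%:R ^+ 2) - s * x2%:R)
    * qpoch pinv pinv x1 * qpoch (pa s) pinv x1
    / (qpoch pinv pinv x2 * qpoch pinv pinv (x1 - x2)%N * qpoch (pa s) pinv x2)
  else 0.

(* x_i = sum_{j >= i} l_j(k) = #{ j : k_j is an integer >= i } *)
Definition xs (k : 'I_N -> option int) (i : nat) : nat :=
  (\sum_(j < N) (if k j is Some m then nat_of_bool (Posz i <= m)%R else 0))%N.

Definition ys (k : 'I_N -> option int) (i : nat) : nat :=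
  (N - \sum_(j < N) (if k j is Some m then nat_of_bool (- Posz i <= m)%R else 0))%N.

End Meas.

(* Main.v *)
(* Z_p is realised as the inverse limit of the Z/p^n, where every square matrix
   has a Smith form diag(p^l_1, ..., p^l_N).  Let T_c be the number of l_i >= c.
   The exponents are recovered from the T_c, and T_0, ..., T_n depend only on the
   matrix mod p^n.  A matrix whose reduction mod p has corank d is equivalent,
   by a Schur complement, to diag(I, p X) with X of size d; if the matrix is
   uniform mod p^(n+1), then X is uniform mod p^n.  Hence T_0 = N, T_1, T_2, ...
   is a Markov chain whose kernel is the corank distribution of a uniform matrix
   over F_p, and this is exactly P^(0).  Scaling by p^M gives the Haar measure of
   {Sing = k}, as a limit of volumes of sets cut out mod p^n by continuity from
   above; in particular singular k get measure 0.  The levels c > M yield the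
   chain y_i; on the first M + 1 levels the time reversal x -> N - x of P^(0),
   reweighted by gamma^(-s-2N), is P^(s) started from pitilde.  That pitilde has
   total mass 1 is a q-Vandermonde identity. *)
Require Import Defs.
From HB Require Import structures.
From mathcomp Require Import all_boot all_order all_algebra.
From mathcomp Require Import all_classical all_reals all_analysis.
From mathcomp Require Import perm ring zify.
From mathcomp Require cyclic mxabelem.
Set Implicit Arguments.
Unset Strict Implicit.
Unset Printing Implicit Defensive.
Import Order.TTheory GRing.Theory Num.Theory numFieldNormedType.Exports.
Local Open Scope classical_set_scope.
Local Open Scope ring_scope.

(** * The ring of p-adic integers *)

(** [qadd] and [qmul] act on digit expansions and offer no ring to compute in, so all linear algebra
    takes place over [padic p] and is carried to Q_p by [piota M], which sends x to p^(-M) x.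
    Finitely many entries admit a common M; hence the parameter M in every statement about Q_p. The
    T_c are read from a Smith form picked by choice, and that they depend only on a residue of the
    matrix comes from a determinant argument mod p. Uniform laws are cardinalities of finite sets of
    residues, and their invariance is the bijectivity of a map on such a set. The parameter s enters
    only at the end: gamma is constant on {Sing = k}, and for products longer than M the two sides
    of the theorem agree before any limit is taken, so that only the limit of a product of P^(0)
    factors remains. *)

Record padic (p : nat) := Padic {
  red : nat -> nat;
  redS : forall n, red n = (red n.+1 %% base p ^ n)%N }.

HB.instance Definition _ p := gen_eqMixin (padic p).
HB.instance Definition _ p := gen_choiceMixin (padic p).

Section PadicRing.
Variable p : nat.
Local Notation b := (base p).
Implicit Types x y z : padic p.

Lemma base_gt1 : (1 < b)%N.
Proof. by rewrite /base leq_maxr. Qed.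

Lemma expb_gt0 n : (0 < b ^ n)%N.
Proof. by rewrite expn_gt0 base_gt0. Qed.

Lemma padicP x y : (forall n, red x n = red y n) -> x = y.
Proof.
case: x y => [f hf] [g hg] /= /funext fg; rewrite fg in hf *.
by congr Padic; exact: Prop_irrelevance.
Qed.

Lemma red_mod x m n : (m <= n)%N -> (red x n %% b ^ m)%N = red x m.
Proof.
move=> /subnKC <-; elim: (n - m)%N => [|k <-].
  by rewrite addn0 redS modn_mod.
by rewrite [in RHS]redS addnS modn_dvdm // dvdn_exp2l // leq_addr.
Qed.

Lemma red_modn x n : (red x n %% b ^ n)%N = red x n.
Proof. exact: red_mod. Qed.

(** The law [redS] reduces mod [b ^ n] besides linking consecutive levels, so every [red x n] is a
    canonical representative and equality in Z_p is plain equality. *)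
Lemma red_lt x n : (red x n < b ^ n)%N.
Proof. by rewrite -red_modn ltn_pmod ?expb_gt0. Qed.

Lemma red0 x : red x 0 = 0%N.
Proof. by have := red_lt x 0; rewrite expn0; case: (red x 0). Qed.

Section Limit.
Variable f : nat -> nat.
Hypothesis fP : forall n, f n.+1 = f n %[mod b ^ n].

Lemma padic_lim_subproof n :
  (f n %% b ^ n = (f n.+1 %% b ^ n.+1) %% b ^ n)%N.
Proof. by rewrite modn_dvdm ?fP // dvdn_exp2l. Qed.

(** Terms are reduced here once and for all, so the ring operations can be given by unreduced
    formulas that are merely compatible mod [b ^ n]. *)
Definition padic_lim : padic p := Padic padic_lim_subproof.
End Limit.

Fact padic_add_subproof x y n :
  (red x n.+1 + red y n.+1 = red x n + red y n %[mod b ^ n])%N.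
Proof. by rewrite -modnDm !red_mod. Qed.
Definition padic_add x y := padic_lim (padic_add_subproof x y).

Fact padic_mul_subproof x y n :
  (red x n.+1 * red y n.+1 = red x n * red y n %[mod b ^ n])%N.
Proof. by rewrite -modnMm !red_mod. Qed.
Definition padic_mul x y := padic_lim (padic_mul_subproof x y).

Definition padic_nat k : padic p := padic_lim (fun n => erefl (k %% b ^ n)%N).

Fact padic_opp_subproof x n :
  (b ^ n.+1 - red x n.+1 = b ^ n - red x n %[mod b ^ n])%N.
Proof.
apply/eqP; rewrite -(eqn_modDr (red x n)) subnK ?(ltnW (red_lt _ _)) //.
rewrite -(modnDmr _ (red x n)) -(red_mod x (leqnSn n)) modn_mod modnDmr.
by rewrite subnK ?(ltnW (red_lt _ _)) // expnS modnMl modnn.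
Qed.
Definition padic_opp x := padic_lim (padic_opp_subproof x).

Fact padic_addA : associative padic_add.
Proof. by move=> x y z; apply: padicP => n /=; rewrite modnDml modnDmr addnA. Qed.
Fact padic_addC : commutative padic_add.
Proof. by move=> x y; apply: padicP => n /=; rewrite addnC. Qed.
Fact padic_add0 : left_id (padic_nat 0) padic_add.
Proof. by move=> x; apply: padicP => n /=; rewrite mod0n add0n red_modn. Qed.
Fact padic_addN : left_inverse (padic_nat 0) padic_opp padic_add.
Proof.
move=> x; apply: padicP => n /=.
by rewrite modnDml subnK ?(ltnW (red_lt _ _)) // modnn mod0n.
Qed.
Fact padic_mulA : associative padic_mul.
Proof. by move=> x y z; apply: padicP => n /=; rewrite modnMml modnMmr mulnA. Qed.
Fact padic_mulC : commutative padic_mul.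
Proof. by move=> x y; apply: padicP => n /=; rewrite mulnC. Qed.
Fact padic_mul1 : left_id (padic_nat 1) padic_mul.
Proof. by move=> x; apply: padicP => n /=; rewrite modnMml mul1n red_modn. Qed.
Fact padic_mulD : left_distributive padic_mul padic_add.
Proof.
by move=> x y z; apply: padicP => n /=; rewrite modnMml modnDml modnDmr mulnDl.
Qed.
Fact padic_1_neq0 : padic_nat 1 != padic_nat 0.
Proof.
apply/eqP => /(congr1 (fun x => red x 1)) /=.
by rewrite expn1 mod0n modn_small // base_gt1.
Qed.

HB.instance Definition _ := GRing.isZmodule.Build (padic p)
  padic_addA padic_addC padic_add0 padic_addN.
HB.instance Definition _ := GRing.Zmodule_isComNzRing.Build (padic p)
  padic_mulA padic_mulC padic_mul1 padic_mulD padic_1_neq0.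

(** Mere existence of an inverse, which makes sense for every base; the criterion mod p needs
    primality and is [padic_unitE]. *)
Definition padic_unit : pred (padic p) := fun x => `[< exists y, y * x = 1 >].
Definition padic_inv x : padic p :=
  if pselect (exists y, y * x = 1) is left h then projT1 (cid h) else x.

Fact padic_mulV : {in padic_unit, left_inverse 1 padic_inv *%R}.
Proof.
move=> x /asboolP h; rewrite /padic_inv; case: pselect => // h'.
by case: (cid h').
Qed.
Fact padic_unitP x y : y * x = 1 -> padic_unit x.
Proof. by move=> h; apply/asboolP; exists y. Qed.
Fact padic_inv_out : {in [predC padic_unit], padic_inv =1 id}.
Proof.
move=> x; rewrite inE /= => /asboolPn h; rewrite /padic_inv; case: pselect => //.
Qed.

HB.instance Definition _ := GRing.ComNzRing_hasMulInverse.Build (padic p)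
  padic_mulV padic_unitP padic_inv_out.

Lemma redD x y n : red (x + y) n = ((red x n + red y n) %% b ^ n)%N.
Proof. by []. Qed.
Lemma redM x y n : red (x * y) n = ((red x n * red y n) %% b ^ n)%N.
Proof. by []. Qed.
Lemma red_nat k n : red (k%:R : padic p) n = (k %% b ^ n)%N.
Proof.
elim: k => [|k IH]; first by rewrite mulr0n.
by rewrite -addn1 natrD redD IH /= modnDm.
Qed.

Lemma red_sum (I : Type) (r : seq I) (F : I -> padic p) n :
  red (\sum_(i <- r) F i) n = ((\sum_(i <- r) red (F i) n) %% b ^ n)%N.
Proof.
elim: r => [|i r IH]; first by rewrite !big_nil.
by rewrite !big_cons redD IH modnDmr.
Qed.

Definition unif : padic p := b%:R.

Lemma redXM k x n : red (unif ^+ k * x) (k + n) = (b ^ k * red x n)%N.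
Proof.
rewrite redM /unif -natrX red_nat modnMml expnD -muln_modr red_mod ?leq_addl //.
Qed.

Lemma red_eq0P x n : reflect (exists z, x = unif ^+ n * z) (red x n == 0%N).
Proof.
apply: (iffP eqP) => [x0|[z ->]]; last first.
  by rewrite -[X in red _ X]addn0 redXM red0 muln0.
have dv m : (b ^ n %| red x (n + m))%N.
  by rewrite /dvdn red_mod ?x0 // leq_addr.
(* The quotient by p^n is built level by level; its level m comes from level n + m of x. *)
have zP m : (red x (n + m.+1) %/ b ^ n = red x (n + m) %/ b ^ n %[mod b ^ m])%N.
  apply/eqP; rewrite -(eqn_pmul2l (expb_gt0 n)) !muln_modr -expnD.
  by rewrite ![(b ^ n * (_ %/ _))%N]mulnC !divnK // !red_mod // addnS.
exists (padic_lim zP); apply: padicP => m.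
have <- : (red x (n + m) %% b ^ m)%N = red x m by rewrite red_mod // leq_addl.
rewrite -[RHS](red_mod _ (leq_addl n m)) redXM /= muln_modr -expnD.
by rewrite [(b ^ n * (_ %/ _))%N]mulnC divnK // red_modn.
Qed.

Lemma red_eqP x y n :
  reflect (exists z, x = y + unif ^+ n * z) (red x n == red y n).
Proof.
apply: (iffP eqP) => [xy|[z ->]]; last first.
  have /eqP z0 : red (unif ^+ n * z) n == 0%N by apply/red_eq0P; exists z.
  by rewrite redD z0 addn0 red_modn.
have /red_eq0P [z xyz] : red (x - y) n == 0%N.
  have : red (x - y + y) n = red y n by rewrite subrK xy.
  rewrite redD; move/eqP; rewrite -[X in _ == X]red_modn -[X in _ == (X %% _)%N]add0n.
  by rewrite eqn_modDr mod0n red_modn.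
by exists z; rewrite -xyz addrC subrK.
Qed.

(** Multiplication by p^k only shifts reductions, so it can be cancelled; this stands in for an
    integral domain structure. *)
Lemma unif_lreg k x : unif ^+ k * x = 0 -> x = 0.
Proof.
move=> x0; apply: padicP => n; have := redXM k x n; rewrite x0 /= mod0n => /esym/eqP.
by rewrite muln_eq0 gtn_eqF ?expb_gt0 //= => /eqP ->; rewrite mod0n.
Qed.

End PadicRing.

Section PadicPrime.
Variables (p : nat) (hp : prime p).
Local Notation b := (base p).
Implicit Types x y : padic p.

Lemma base_prime : b = p.
Proof. by rewrite /base; apply/maxn_idPl/prime_gt1. Qed.

(** A residue prime to p is inverted mod each [b ^ n] by one of its powers, by Euler's theorem;
    inverses being unique, these are compatible and define an inverse in Z_p. *)
Lemma padic_unitE x : (x \is a GRing.unit) = (red x 1 != 0%N).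
Proof.
apply/idP/idP => [/mulVr/(congr1 (fun y => red y 1))|x0].
  rewrite redM (red_nat p 1) expn1 (modn_small (base_gt1 p)).
  by case: eqP => // ->; rewrite muln0 mod0n.
have cop n : coprime (red x n) (b ^ n).
  case: n => [|n]; first by rewrite expn0 coprimen1.
  rewrite coprime_sym; apply: coprimeXl.
  have pb : prime b by rewrite base_prime.
  by rewrite prime_coprime // -{1}(expn1 b) /dvdn red_mod.
have inv_ex n : exists c, (c * red x n = 1 %[mod b ^ n])%N.
  exists (red x n ^ (totient (b ^ n)).-1)%N.
  rewrite -expnSr prednK ?totient_gt0 ?expb_gt0 //; exact: cyclic.Euler_exp_totient.
pose c n := projT1 (cid (inv_ex n)).
have cP n : (c n * red x n = 1 %[mod b ^ n])%N by rewrite /c; case: cid.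
have cS n : (c n.+1 = c n %[mod b ^ n])%N.
  have c1 : (c n.+1 * red x n = 1 %[mod b ^ n])%N.
    rewrite -(red_mod x (leqnSn n)) modnMmr.
    have d : (b ^ n %| b ^ n.+1)%N by rewrite dvdn_exp2l.
    by rewrite -(modn_dvdm _ d) cP modn_dvdm.
  rewrite -[c n.+1]muln1 -modnMmr -(cP n) modnMmr mulnCA -modnMmr c1.
  by rewrite modnMmr muln1.
apply/unitrPr; exists (padic_lim cS); apply: padicP => n.
rewrite redM (red_nat p 1) /= modnMmr mulnC; exact: cP.
Qed.

End PadicPrime.

(** * Smith form over the p-adic integers *)

Section MxEquiv.
Variable R : comUnitRingType.

Definition mxequiv m (A B : 'M[R]_m) : Prop :=
  exists U V, [/\ U \in unitmx, V \in unitmx & B = U *m A *m V].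

Lemma mxequiv_refl m (A : 'M[R]_m) : mxequiv A A.
Proof. by exists 1%:M, 1%:M; rewrite unitmx1 mul1mx mulmx1. Qed.

Lemma mxequiv_sym m (A B : 'M[R]_m) : mxequiv A B -> mxequiv B A.
Proof.
move=> [U [V [Uu Vu ->]]]; exists (invmx U), (invmx V).
by rewrite !unitmx_inv !mulmxA mulVmx // mul1mx mulmxK.
Qed.

Lemma mxequiv_trans m (A B C : 'M[R]_m) :
  mxequiv A B -> mxequiv B C -> mxequiv A C.
Proof.
move=> [U [V [Uu Vu ->]]] [U' [V' [Uu' Vu' ->]]]; exists (U' *m U), (V *m V').
by rewrite !unitmx_mul Uu Uu' Vu Vu' !mulmxA.
Qed.

Lemma mxequivZ m (A B : 'M[R]_m) a : mxequiv A B -> mxequiv (a *: A) (a *: B).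
Proof.
move=> [U [V [Uu Vu ->]]]; exists U, V.
by rewrite -scalemxAr -scalemxAl.
Qed.

Lemma mxequiv_block m n (C : 'M[R]_m) (A B : 'M[R]_n) : mxequiv A B ->
  mxequiv (block_mx C 0 0 A) (block_mx C 0 0 B).
Proof.
move=> [U [V [Uu Vu ->]]].
exists (block_mx 1%:M 0 0 U), (block_mx 1%:M 0 0 V).
rewrite !unitmxE !det_ublock !det1 !mul1r -!unitmxE; split=> //.
by rewrite !mulmx_block !(mul0mx, mulmx0, mul1mx, mulmx1, addr0, add0r).
Qed.

(** Row and column elimination with the invertible corner [A] as pivot. *)
Lemma mxequiv_schur m n (A : 'M[R]_m) B C (D : 'M[R]_n) : A \in unitmx ->
  mxequiv (block_mx A B C D) (block_mx 1%:M 0 0 (D - C *m invmx A *m B)).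
Proof.
move=> Au; exists (block_mx 1%:M 0 (- (C *m invmx A)) 1%:M).
exists (block_mx (invmx A) (- (invmx A *m B)) 0 1%:M).
rewrite !unitmxE det_lblock det_ublock !det1 !mul1r mulr1 unitr1 -unitmxE.
rewrite unitmx_inv; split=> //.
rewrite !mulmx_block !(mul0mx, mulmx0, mul1mx, mulmx1, addr0, add0r).
rewrite !mulNmx -!mulmxA mulVmx // mulmx1 addNr !mul0mx add0r.
by rewrite mulmxN (mulmxA A) mulmxV // mul1mx addNr (addrC D).
Qed.
End MxEquiv.

Section SmithForm.
Variables (p : nat) (hp : prime p).
Local Notation Zp := (padic p).
Local Notation unif := (unif p).

(* Exponents are in [option nat], [None] standing for +oo, i.e. p ^ None = 0 *)
Definition leo (a b : option nat) : bool :=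
  match b, a with
  | None, _ => true
  | Some _, None => false
  | Some y, Some x => (x <= y)%N
  end.

Definition upow (a : option nat) : Zp := if a is Some v then unif ^+ v else 0.

Definition udiag n (lam : 'I_n -> option nat) : 'M[Zp]_n :=
  diag_mx (\row_i upow (lam i)).

Definition sortedo n (lam : 'I_n -> option nat) : Prop :=
  forall i j : 'I_n, (i <= j)%N -> leo (lam i) (lam j).

Lemma upow_addn v a : upow (omap (addn v) a) = unif ^+ v * upow a.
Proof. by case: a => [w|] /=; rewrite ?exprD ?mulr0. Qed.

Lemma udiag_addn v n (lam : 'I_n -> option nat) :
  udiag (fun i => omap (addn v) (lam i)) = unif ^+ v *: udiag lam.
Proof.
by apply/matrixP => i j; rewrite !mxE upow_addn mulrnAr.
Qed.

Definition opad r d (lam : 'I_d -> option nat) (i : 'I_(r + d)) : option nat :=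
  match fintype.split i with inl _ => Some 0%N | inr j => lam j end.

Lemma udiag_opad r d (lam : 'I_d -> option nat) :
  udiag (@opad r d lam) = block_mx 1%:M 0 0 (udiag lam).
Proof.
rewrite /udiag -diag_const_mx -diag_mx_row; congr diag_mx.
apply/rowP => i; rewrite !mxE /opad; case: fintype.splitP => j _; rewrite mxE //.
Qed.

Lemma sortedo_opad r d (lam : 'I_d -> option nat) :
  sortedo lam -> sortedo (@opad r d lam).
Proof.
move=> hl i j; rewrite /opad; case: fintype.splitP => i' ->; case: fintype.splitP => j' -> //=.
- by move=> _; case: (lam j').
- by move=> h; have := ltn_ord j'; rewrite ltnNge (leq_trans _ h) ?leq_addr.
- by rewrite leq_add2l; apply: hl.
Qed.

(** Factoring out the largest power p^v that divides all entries leaves a unit entry, which serves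
    as pivot for a Schur complement; induction treats the complement. Since p^v is taken out
    beforehand, the exponents come out sorted. *)
Lemma smith_form n (A : 'M[Zp]_n) :
  exists lam, sortedo lam /\ mxequiv A (udiag lam).
Proof.
elim: n => [|n IH] in A *.
  exists (fun=> None); split; first by case.
  rewrite [A]thinmx0 [udiag _]thinmx0; exact: mxequiv_refl.
have [->|A0] := eqVneq A 0.
  exists (fun=> None); split=> //.
  suff -> : @udiag n.+1 (fun=> None) = 0 by exact: mxequiv_refl.
  by apply/matrixP => i j; rewrite !mxE mul0rn.
have nz : exists v, [exists i, exists j, red (A i j) v != 0%N].
  apply: contrapT => /forallNP h; move/eqP: A0; apply; apply/matrixP => i j.
  apply: padicP => v; rewrite mxE /= mod0n; apply/eqP; apply: contrapT => /negP hv.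
  by apply: (h v); apply/existsP; exists i; apply/existsP; exists j.
(* All entries vanish at level 0, so the least level with a nonzero entry is some v + 1, and p^v
   divides every entry. *)
case: (ex_minnP nz) => -[|v] /existsP[i0 /existsP[j0 hij]] vmin.
  by rewrite red0 in hij.
have dvA ij : exists z, A ij.1 ij.2 = unif ^+ v * z.
  apply/red_eq0P; apply: contrapT => /negP h.
  suff /vmin : [exists i, exists j, red (A i j) v != 0%N] by rewrite ltnn.
  by apply/existsP; exists ij.1; apply/existsP; exists ij.2.
have [f fA] := choice dvA.
pose A1 : 'M[Zp]_n.+1 := \matrix_(i, j) f (i, j).
have AE : A = unif ^+ v *: A1 by apply/matrixP => i j; rewrite !mxE -fA.
have A1u : A1 i0 j0 \is a GRing.unit.
  rewrite padic_unitE //; apply: contraNneq hij => z0.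
  by rewrite AE mxE -(addn1 v) redXM z0 muln0.
pose A2 : 'M[Zp]_(1 + n) := xcol j0 0 (xrow i0 0 A1).
have A12 : mxequiv A1 A2.
  exists (tperm_mx i0 0), (tperm_mx j0 0); rewrite !unitmx_perm; split=> //.
  by rewrite /A2 xcolE xrowE.
have A2u : ulsubmx A2 \in unitmx.
  have l0 : lshift n (0 : 'I_1) = 0 :> 'I_n.+1 by apply: val_inj.
  have A20 : A2 0 0 = A1 i0 j0 by rewrite /A2 /xcol /xrow mxE mxE !tpermR.
  rewrite unitmxE det_mx11 -(block_mxEul _ (ursubmx A2) (dlsubmx A2) (drsubmx A2)).
  by rewrite submxK l0 A20.
have A23 := mxequiv_schur (ursubmx A2) (dlsubmx A2) (drsubmx A2) A2u.
rewrite submxK in A23.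
have [mu [mus Dmu]] := IH (drsubmx A2 - dlsubmx A2 *m invmx (ulsubmx A2) *m ursubmx A2).
have A4 := mxequiv_trans A12 (mxequiv_trans A23 (mxequiv_block 1%:M Dmu)).
exists (fun i => omap (addn v) (@opad 1 n mu i)); split.
  move=> i j ij; have := @sortedo_opad 1 n mu mus i j ij; move: (@opad 1 n mu i) (@opad 1 n mu j) => [a|] [c|] //=.
  by rewrite leq_add2l.
by rewrite udiag_addn (@udiag_opad 1 n mu) AE; apply: mxequivZ.
Qed.

(** Pigeonhole: each permutation sends some row of [P] outside [Q], so each term of the Leibniz
    expansion has a factor divisible by p. *)
Lemma red1_det_eq0 n (V : 'M[Zp]_n) (P Q : pred 'I_n) :
  (forall i j, P i -> ~~ Q j -> red (V i j) 1 = 0%N) ->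
  (#|Q| < #|P|)%N -> red (\det V) 1 = 0%N.
Proof.
move=> hV hPQ; rewrite /determinant red_sum big1 ?mod0n // => s _.
have [i Pi Qsi] : exists2 i, P i & ~~ Q (s i).
  apply: contrapT => h; move: hPQ; rewrite ltnNge => /negP; apply.
  rewrite -(fintype.card_image (@perm_inj _ s)); apply/subset_leq_card/fintype.subsetP.
  move=> j /fintype.imageP[i Pi ->]; apply: contrapT => /negP Qsi; apply: h.
  by exists i.
by rewrite (bigD1 i) // mulrCA redM (hV _ _ Pi Qsi) mul0n mod0n.
Qed.

(** If lam i <= c < mu j, the (i, j) entry of [udiag lam *m V] is divisible by p^(c+1), so p divides
    V i j. Were the inequality false, these entries would form a zero block mod p large enough to
    kill the determinant of the invertible [V]. *)
Lemma card_leo_le n (lam mu : 'I_n -> option nat) U V W m c :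
  U \in unitmx -> V \in unitmx ->
  U *m udiag lam *m V = udiag mu + unif ^+ m *: W -> (c < m)%N ->
  (#|[pred i | leo (lam i) (Some c)]| <= #|[pred i | leo (mu i) (Some c)]|)%N.
Proof.
move=> Uu Vu E cm; rewrite leqNgt; apply/negP => hlt.
have : \det V \is a GRing.unit by rewrite -unitmxE.
rewrite padic_unitE // => /eqP; apply; apply: red1_det_eq0 hlt => i j /=.
have {}E : udiag lam *m V = invmx U *m udiag mu + unif ^+ m *: (invmx U *m W).
  have := congr1 (mulmx (invmx U)) E.
  by rewrite !mulmxA mulVmx // mul1mx mulmxDr -scalemxAr.
have := congr1 (fun M : 'M[Zp]_n => M i j) E.
rewrite mul_diag_mx mul_mx_diag !mxE.
case: (lam i) => // a /=; set Y := invmx U i j => EV ac muc.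
have [z zE] : exists z, upow (mu j) = unif ^+ c.+1 * z.
  case: (mu j) muc => [d|] /=; last by exists 0; rewrite mulr0.
  by rewrite -ltnNge => cd; exists (unif ^+ (d - c.+1)); rewrite -exprD subnKC.
apply/eqP/red_eq0P.
pose k := (c - a)%N.
have ck : c.+1 = (a + k.+1)%N by rewrite addnS subnKC.
have e1 : unif ^+ c.+1 = unif ^+ a * (unif * unif ^+ k) by rewrite ck exprD exprS.
have e2 : unif ^+ m = unif ^+ c.+1 * unif ^+ (m - c.+1) by rewrite -exprD subnKC.
pose w := \sum_j0 invmx U i j0 * W j0 j.
(* The right side of [EV] is p^(c+1) times the bracket, and c + 1 = a + 1 + k; cancelling p^a leaves
   p times this witness. *)
exists (unif ^+ k * (Y * z + unif ^+ (m - c.+1) * w)).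
apply/eqP; rewrite -subr_eq0; apply/eqP/(@unif_lreg p a).
rewrite mulrBr EV zE -/w e2 e1 /=; ring.
Qed.

(** The T_c of a list of exponents; [None] counts for every c. *)
Definition ngeo n (lam : 'I_n -> option nat) (c : nat) : nat :=
  \sum_(i < n) leo (Some c) (lam i).

Lemma ngeo0 n (lam : 'I_n -> option nat) : ngeo lam 0 = n.
Proof.
rewrite /ngeo -[RHS]card_ord -sum1_card; apply: eq_big => // i _.
by case: (lam i).
Qed.

Lemma ngeoS n (lam : 'I_n -> option nat) c :
  ngeo lam c.+1 = (n - #|[pred i | leo (lam i) (Some c)]|)%N.
Proof.
rewrite -[X in (X - _)%N]card_ord -(cardC [pred i | leo (lam i) (Some c)]) addKn.
rewrite -sum1_card /ngeo [RHS]big_mkcond /=; apply: eq_bigr => i _.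
by rewrite !inE /=; case: (lam i) => //= a; rewrite ltnNge; case: (_ <= _)%N.
Qed.

Lemma ngeo_opad r d (lam : 'I_d -> option nat) c :
  ngeo (@opad r d (fun i => omap (addn 1) (lam i))) c.+1 = ngeo lam c.
Proof.
rewrite /ngeo big_split_ord /= big1 ?add0n => [|i _].
  apply: eq_bigr => i _; rewrite /opad.
  case: fintype.splitP => j /= E; first by have := ltn_ord j; rewrite -E ltnNge leq_addr.
  have -> : j = i by apply/val_inj/eqP; rewrite /= -(eqn_add2l r) E.
  by case: (lam i).
rewrite /opad; case: fintype.splitP => j //= E.
by have := ltn_ord i; rewrite E ltnNge leq_addr.
Qed.

Lemma ngeo_addn n v (lam : 'I_n -> option nat) c :
  ngeo (fun i => omap (addn v) (lam i)) c = ngeo lam (c - v).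
Proof.
apply: eq_bigr => i _; case: (lam i) => //= a; congr nat_of_bool.
by rewrite leq_subLR.
Qed.

(* The number of invariant factors of [A] divisible by [p ^ c]. *)
Definition ndiv n (A : 'M[Zp]_n) : nat -> nat := ngeo (projT1 (cid (smith_form A))).

(** [card_leo_le] in both directions. T_c is determined by the number of exponents <= c - 1, so c =
    m is still allowed. With W = 0 it shows independence of the Smith form chosen in [ndiv]. *)
Lemma ndivE n (A B W : 'M[Zp]_n) lam m c :
  A = B + unif ^+ m *: W -> mxequiv B (udiag lam) -> (c <= m)%N ->
  ndiv A c = ngeo lam c.
Proof.
move=> AB Blam; rewrite /ndiv; case: cid => mu /= [_ Amu].
case: c => [|c] cm; first by rewrite !ngeo0.
rewrite !ngeoS; congr subn; apply/eqP; rewrite eqn_leq.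
have [U [V [Uu Vu E]]] := Blam; have [U' [V' [Uu' Vu' E']]] := Amu.
apply/andP; split; last first.
  apply: (@card_leo_le n lam mu (U' *m invmx U) (invmx V *m V') (U' *m (- W) *m V') m) => //.
  - by rewrite unitmx_mul unitmx_inv Uu' Uu.
  - by rewrite unitmx_mul unitmx_inv Vu Vu'.
  rewrite E E' -!mulmxA (mulKmx Uu) (mulKVmx Vu) AB mulmxDl mulmxDr.
  by rewrite !mulNmx !mulmxN scalerN -scalemxAl -scalemxAr addrK.
apply: (@card_leo_le n mu lam (U *m invmx U') (invmx V' *m V) (U *m W *m V) m) => //.
- by rewrite unitmx_mul unitmx_inv Uu' Uu.
- by rewrite unitmx_mul unitmx_inv Vu Vu'.
rewrite E E' -!mulmxA (mulKmx Uu') (mulKVmx Vu') AB mulmxDl mulmxDr.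
by rewrite -scalemxAl -scalemxAr.
Qed.

Lemma ndiv_equiv n (A : 'M[Zp]_n) lam c :
  mxequiv A (udiag lam) -> ndiv A c = ngeo lam c.
Proof.
move=> h; apply: (@ndivE n A A 0 lam c c) => //; by rewrite scaler0 addr0.
Qed.

Lemma ndiv_congr n (A B W : 'M[Zp]_n) m c :
  A = B + unif ^+ m *: W -> (c <= m)%N -> ndiv A c = ndiv B c.
Proof.
move=> AB cm; have [lam [_ Blam]] := smith_form B.
by rewrite (ndivE AB Blam cm) (ndiv_equiv c Blam).
Qed.

Lemma ndiv_mxequiv n (A B : 'M[Zp]_n) c : mxequiv A B -> ndiv A c = ndiv B c.
Proof.
move=> AB; have [lam [_ Blam]] := smith_form B.
by rewrite (ndiv_equiv c Blam) (ndiv_equiv c (mxequiv_trans AB Blam)).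
Qed.

Lemma ndiv0 n (A : 'M[Zp]_n) : ndiv A 0 = n.
Proof. exact: ngeo0. Qed.

(** The time shift of the Markov chain: the unit block counts in T_0 only, and the factor p raises
    every level by one. *)
Lemma ndiv_block r d (X : 'M[Zp]_d) c :
  ndiv (block_mx (1%:M : 'M[Zp]_r) 0 0 (unif *: X)) c.+1 = ndiv X c.
Proof.
have [lam [_ Xlam]] := smith_form X.
rewrite (ndiv_equiv c Xlam) -(ngeo_opad r); apply: ndiv_equiv.
rewrite udiag_opad udiag_addn expr1.
by apply: mxequiv_block; apply: mxequivZ.
Qed.

Lemma ndivZ n v (A : 'M[Zp]_n) c : ndiv (unif ^+ v *: A) c = ndiv A (c - v).
Proof.
have [lam [_ Alam]] := smith_form A.
rewrite (ndiv_equiv _ Alam) -ngeo_addn; apply: ndiv_equiv.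
by rewrite udiag_addn; apply: mxequivZ.
Qed.

End SmithForm.

(** * Counting matrices of given rank over a finite field *)

Section QPochhammer.
Variable R : realType.
Implicit Types a q : R.

Lemma qpoch0 a q : qpoch a q 0 = 1.
Proof. by rewrite /qpoch big_ord0. Qed.

Lemma qpochS a q n : qpoch a q n.+1 = qpoch a q n * (1 - a * q ^+ n).
Proof. by rewrite /qpoch big_ord_recr. Qed.

Lemma qpoch_gt0 a q n : a < 1 -> 0 < q < 1 -> 0 < a -> 0 < qpoch a q n.
Proof.
move=> a1 /andP[q0 q1] a0; apply: prodr_gt0 => i _; rewrite subr_gt0.
apply: (le_lt_trans _ a1); rewrite ler_piMr ?(ltW a0) //.
by rewrite exprn_ile1 // ltW.
Qed.

End QPochhammer.

Section RankCount.
Variable F : finFieldType.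

Definition nrank m n r : nat := #|[pred A : 'M[F]_(m, n) | \rank A == r]|.

Lemma nrank0 m n : nrank m n 0 = 1%N.
Proof.
by rewrite -(card1 (0 : 'M[F]_(m, n))); apply: eq_card => A; rewrite !inE mxrank_eq0.
Qed.

Lemma nrank_big m n r : (m < r)%N -> nrank m n r = 0%N.
Proof.
move=> mr; apply: eq_card0 => A; rewrite inE; apply/negbTE.
by apply: contraTneq (rank_leq_row A) => ->; rewrite -ltnNge.
Qed.

Lemma rank_col_mx1 m n (v : 'rV[F]_n) (B : 'M[F]_(m, n)) :
  \rank (col_mx v B) = (\rank B + ~~ (v <= B)%MS)%N.
Proof.
rewrite -addsmxE; have [vB|vB] /= := boolP (v <= B)%MS.
  by rewrite addn0; apply/eqmx_rank/eqmxP/addsmx_idPr.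
apply/eqP; rewrite eqn_leq; apply/andP; split.
  have := mxrank_adds_leqif v B; case=> h _; apply: leq_trans h _.
  by rewrite addnC leq_add2l rank_leq_row.
rewrite addn1 ltn_neqAle mxrankS ?addsmxSr // andbT.
by rewrite (mxrank_leqif_sup (addsmxSr v B)) addsmx_sub submx_refl andbT.
Qed.

(** A matrix is a first row [v] above a block [B]. Rank r + 1 arises from [B] of rank r + 1 with [v]
    in its row space, or from [B] of rank r with [v] outside it. *)
Lemma nrankS m n r :
  nrank m.+1 n r.+1 =
  (#|F| ^ r.+1 * nrank m n r.+1 + (#|F| ^ n - #|F| ^ r) * nrank m n r)%N.
Proof.
have cardv (B : 'M[F]_(m, n)) :
    (\sum_(v : 'rV[F]_n) (\rank (col_mx v B) == r.+1) =
     (\rank B == r.+1) * #|F| ^ r.+1 + (\rank B == r) * (#|F| ^ n - #|F| ^ r))%N.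
  under eq_bigr => v _ do rewrite rank_col_mx1.
  have inB : (\sum_(v : 'rV[F]_n) (v <= B)%MS = #|F| ^ \rank B)%N.
    rewrite -mxabelem.card_rowg -sum1_card [RHS]big_mkcond /=.
    by apply: eq_bigr => v _; rewrite mxabelem.mem_rowg; case: (_ <= _)%MS.
  have outB : (\sum_(v : 'rV[F]_n) ~~ (v <= B)%MS = #|F| ^ n - #|F| ^ \rank B)%N.
    have -> : (#|F| ^ n = #|{: 'rV[F]_n}|)%N by rewrite card_mx mul1n.
    rewrite -inB -sum1_card.
    have <- : (\sum_(v : 'rV[F]_n) ((v <= B)%MS + ~~ (v <= B)%MS) =
               \sum_(v in {: 'rV[F]_n}) 1)%N.
      by apply: eq_big => // v _; case: (_ <= _)%MS.
    by rewrite big_split /= addKn.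
  have [Br|Br] := eqVneq (\rank B) r.+1.
    rewrite Br gtn_eqF // mul0n mul1n addn0 -Br -inB; apply: eq_bigr => v _.
    by case: (_ <= _)%MS => /=; rewrite ?addn0 ?addn1 ?eqxx // gtn_eqF.
  rewrite mul0n add0n; have [B'|B'] := eqVneq (\rank B) r.
    rewrite mul1n -B' -outB; apply: eq_bigr => v _.
    by case: (_ <= _)%MS => /=; rewrite ?addn0 ?addn1 ?eqxx // ltn_eqF.
  rewrite mul0n big1 // => v _.
  by case: (_ <= _)%MS => /=; rewrite ?addn0 ?addn1 ?eqSS ?(negbTE Br) ?(negbTE B').
have -> : nrank m.+1 n r.+1 =
    (\sum_(B : 'M[F]_(m, n)) \sum_(v : 'rV[F]_n) (\rank (col_mx v B) == r.+1))%N.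
  rewrite /nrank -sum1_card big_mkcond /= exchange_big pair_big /=.
  rewrite (reindex (fun vB : 'rV[F]_n * 'M[F]_(m, n) => col_mx vB.1 vB.2 : 'M[F]_(1 + m, n))) /=.
    by apply: eq_bigr => -[v B] _ /=; rewrite inE; case: (_ == _).
  exists (fun A : 'M[F]_(1 + m, n) => (usubmx A, dsubmx A)) => [[v B]|A] _ /=.
    by rewrite col_mxKu col_mxKd.
  by rewrite vsubmxK.
under eq_bigr => B _ do rewrite cardv.
have cn s : nrank m n s = (\sum_(B : 'M[F]_(m, n)) (\rank B == s))%N.
  rewrite /nrank -sum1_card big_mkcond /=.
  by apply: eq_bigr => B _; rewrite inE; case: (_ == _).
by rewrite big_split /= -!big_distrl /= -!cn mulnC (mulnC (nrank m n r)).
Qed.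

(** The classical count of matrices of given rank, denominators cleared and t = 1/q. Here d and e
    are the row and column coranks; removing a row lowers d, or lowers r and raises e. *)
Lemma nrankE (R : realType) (t : R) d e r :
  t = #|F|%:R^-1 ->
  (nrank (d + r) (e + r) r)%:R * (qpoch t t d * qpoch t t e * qpoch t t r) =
  t^-1 ^+ ((d + r) * (e + r)) * t ^+ (d * e) * (qpoch t t (d + r) * qpoch t t (e + r)).
Proof.
move=> tE.
have q1 : (1 < #|F|)%N by exact: finalg.card_finNzRing_gt1.
have t01 : 0 < t < 1.
  by rewrite tE invr_gt0 invf_lt1 ltr0n ?ltr1n ?(ltnW q1) // q1.
have tn0 : t != 0 by case/andP: t01 => /lt0r_neq0.
have qE : #|F|%:R = t^-1 by rewrite tE invrK.
have [m] := ubnP (d + r); elim: m => // m IH in d e r *.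
case: r => [|r] hm.
  by rewrite nrank0 !addn0 qpoch0 mulr1 exprVn mulVf ?mul1r // expf_neq0.
have h1 k : 1 - t * t ^+ k != 0.
  rewrite subr_eq0 eq_sym lt_eqF // -exprS exprn_ilt1 //; by case/andP: t01 => // /ltW.
rewrite [in nrank _ _ _]addnS nrankS.
have rn : (r <= e + r.+1)%N by lia.
have IH2 := IH d e.+1 r ltac:(lia).
rewrite natrD !natrM natrB ?leq_pexp2l ?(ltnW q1) // !natrX qE.
(* One term of the recursion has column corank e + 1, whose Pochhammer symbol contains this extra
   factor. *)
apply: (mulIf (h1 e)).
case: d => [|d] in hm IH2 *.
  (* For d = 0 only r rows remain, too few for rank r + 1. *)
  rewrite (@nrank_big (0 + r)) // mulr0 add0r.
  rewrite (_ : e.+1 + r = e + r.+1)%N in IH2; last by lia.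
  rewrite !qpoch0 !add0n !mul0n !expr0 !mul1r in IH2 *.
  rewrite !mulr1 in IH2 *; rewrite (qpochS t t e) (qpochS t t r) in IH2 *.
  transitivity ((t^-1 ^+ (e + r.+1) - t^-1 ^+ r) * (1 - t * t ^+ r) *
    ((nrank r (e + r.+1) r)%:R * (qpoch t t e * (1 - t * t ^+ e) * qpoch t t r))).
    by ring.
  rewrite IH2 mulSn (exprD _ (e + r.+1)) (exprD t^-1 e) !exprS !exprVn; field.
  by rewrite ?expf_neq0 ?tn0.
have IH1 := IH d e r.+1 ltac:(lia).
rewrite (_ : e.+1 + r = e + r.+1)%N in IH2; last by lia.
rewrite (_ : d.+1 + r = d + r.+1)%N in IH2 *; last by lia.
rewrite (_ : d.+1 + r.+1 = (d + r.+1).+1)%N; last by lia.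
rewrite (qpochS t t e) in IH2; rewrite (qpochS t t (d + r.+1)).
rewrite (qpochS t t d) (qpochS t t r) in IH1 IH2 *.
transitivity (t^-1 ^+ r.+1 * (1 - t * t ^+ d) * (1 - t * t ^+ e) *
   ((nrank (d + r.+1) (e + r.+1) r.+1)%:R *
    (qpoch t t d * qpoch t t e * (qpoch t t r * (1 - t * t ^+ r)))) +
  (t^-1 ^+ (e + r.+1) - t^-1 ^+ r) * (1 - t * t ^+ r) *
   ((nrank (d + r.+1) (e + r.+1) r)%:R *
   (qpoch t t d * (1 - t * t ^+ d) * (qpoch t t e * (1 - t * t ^+ e)) * qpoch t t r))).
  by ring.
rewrite IH1 IH2 !(mulSn (d + _)) (exprD t^-1 (e + r.+1) ((d + _) * _)).
rewrite !(mulSn d) mulnS !(exprD t) (exprD t^-1 e) !exprS !exprVn; field.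
by rewrite ?expf_neq0 ?tn0.
Qed.

End RankCount.

(** * Counting matrices mod p^n with given elementary divisors *)

(** An up-closed set of indices is a final segment, hence determined by its size; for sorted
    exponents this recovers each of them from the T_c. *)
Lemma monotone_ordE n (P : pred 'I_n) (i : 'I_n) :
  (forall i j : 'I_n, (i <= j)%N -> P i -> P j) ->
  P i = (n <= i + \sum_(j < n) P j)%N.
Proof.
move=> mono.
have cnt m k : (\sum_(j < m) (k <= j) = m - k)%N.
  elim: m => [|m IH]; first by rewrite big_ord0.
  by rewrite big_ord_recr /= IH; case: leqP => /= h; lia.
have [Pi|Pi] := boolP (P i).
  apply/esym; rewrite -leq_subLR -cnt; apply: leq_sum => j _.
  by case: (leqP i j) => // ij; rewrite (mono i j).
apply/esym/negbTE; rewrite -ltnNge.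
have : (\sum_(j < n) P j <= n - i.+1)%N.
  rewrite -cnt; apply: leq_sum => j _.
  by case: (leqP i.+1 j) => [|ji]; rewrite ?leq_b1 // (contraNF (mono j i ji) Pi).
by have := ltn_ord i; lia.
Qed.

Section Counting.
Variables (p : nat) (hp : prime p).
Local Notation Zp := (padic p).
Local Notation unif := (unif p).
Local Notation b := (base p).

Lemma sortedo_geoE n (lam : 'I_n -> option nat) c i : sortedo lam ->
  leo (Some c) (lam i) = (n <= i + ngeo lam c)%N.
Proof.
move=> ls; apply: (@monotone_ordE n (fun i => leo (Some c) (lam i))) => j k /ls.
by case: (lam j) => [a|]; case: (lam k) => [a'|] //= h h'; apply: leq_trans h' h.
Qed.

Lemma sortedo_ngeo_inj n (lam mu : 'I_n -> option nat) :
  sortedo lam -> sortedo mu -> (forall c, ngeo lam c = ngeo mu c) -> lam = mu.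
Proof.
move=> ls ms E; apply/funext => i.
have {}E c : leo (Some c) (lam i) = leo (Some c) (mu i) by rewrite !sortedo_geoE ?E.
case: (lam i) (mu i) E => [a|] [a'|] //= E.
- by congr Some; apply/eqP; rewrite eqn_leq E leqnn -E leqnn.
- by have := E a.+1; rewrite /= ltnn.
- by have := E a'.+1; rewrite /= ltnn.
Qed.

(** * Reduction to the residue field *)

Definition modp (_ : prime p) (x : Zp) : 'F_p := (red x 1)%:R.

Lemma natr_modp k : ((k %% b ^ 1)%N)%:R = k%:R :> 'F_p.
Proof. by rewrite expn1 base_prime // Fp_nat_mod. Qed.

Fact modp_is_zmod_morphism : zmod_morphism (modp hp).
Proof.
move=> x y; apply/eqP; rewrite -subr_eq opprK; apply/eqP.
by rewrite /modp -natrD -[LHS]natr_modp -redD subrK.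
Qed.
Fact modp_is_monoid_morphism : monoid_morphism (modp hp).
Proof.
split=> [|x y]; first by rewrite /modp (red_nat p 1) natr_modp.
by rewrite /modp redM natr_modp natrM.
Qed.
HB.instance Definition _ := GRing.isZmodMorphism.Build Zp 'F_p (modp hp)
  modp_is_zmod_morphism.
HB.instance Definition _ := GRing.isMonoidMorphism.Build Zp 'F_p (modp hp)
  modp_is_monoid_morphism.

Lemma map_modp_unif m k (A : 'M[Zp]_(m, k)) : map_mx (modp hp) (unif *: A) = 0.
Proof.
apply/matrixP => i j; rewrite !mxE /modp.
suff /eqP -> : red (unif * A i j) 1 == 0%N by [].
by apply/red_eq0P; exists (A i j); rewrite expr1.
Qed.

Lemma modp_unitmx n (A : 'M[Zp]_n) : map_mx (modp hp) A = 1%:M -> A \in unitmx.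
Proof.
move=> A1; rewrite unitmxE padic_unitE //; apply/eqP => d0.
have : modp hp (\det A) = 1 by rewrite -det_map_mx A1 det1.
by rewrite /modp d0 => /eqP; rewrite eq_sym oner_eq0.
Qed.

Lemma map_modp_unitmx n (U : 'M[Zp]_n) :
  U \in unitmx -> map_mx (modp hp) U \in unitmx.
Proof. by rewrite !unitmxE det_map_mx => /(rmorph_unit (modp hp)). Qed.

(** In a sorted Smith form the exponents >= 1 are exactly the last d, and a factor p can be taken
    out of each. *)
Lemma ndiv1_block r d (A : 'M[Zp]_(r + d)) : ndiv hp A 1 = d ->
  exists Y : 'M[Zp]_d, mxequiv A (block_mx 1%:M 0 0 (unif *: Y)).
Proof.
have [lam [ls Alam]] := smith_form hp A; rewrite (ndiv_equiv hp 1 Alam) => lamd.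
pose mu (j : 'I_d) := omap predn (lam (rshift r j)).
exists (udiag p mu); suff -> : block_mx 1%:M 0 0 (unif *: udiag p mu) = udiag p lam by [].
rewrite -(expr1 unif) -udiag_addn -udiag_opad; congr udiag; apply/funext => i.
have := sortedo_geoE 1 i ls; rewrite lamd /opad; case: fintype.splitP => j ij.
  rewrite ij leq_add2r leqNgt ltn_ord /=.
  by case: (lam i) => //= -[|a].
have -> : i = rshift r j by apply: val_inj.
rewrite /= addnAC leq_addr /mu; case: (lam _) => //= a a0.
by rewrite add1n prednK.
Qed.

(** The form diag(I, p Y) reduces to diag(I, 0) mod p. *)
Lemma rank_modp n (A : 'M[Zp]_n) : (\rank (map_mx (modp hp) A) + ndiv hp A 1 = n)%N.
Proof.
have : (ndiv hp A 1 <= n)%N.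
  have [lam [_ Alam]] := smith_form hp A; rewrite (ndiv_equiv hp 1 Alam).
  rewrite /ngeo -[X in (_ <= X)%N]card_ord -sum1_card; apply: leq_sum => i _.
  exact: leq_b1.
move: (erefl (ndiv hp A 1)); move: {1 3}(ndiv hp A 1) => d dE dn.
have [r rd] : exists r, n = (r + d)%N by exists (n - d)%N; rewrite subnK.
subst n; rewrite -dE; have Ad := esym dE.
have [Y [U [V [Uu Vu E]]]] := ndiv1_block Ad.
have := congr1 (map_mx (modp hp)) E.
rewrite !map_mxM /= map_block_mx map_mx1 !map_mx0 map_modp_unif.
move=> /(congr1 mxrank); rewrite rank_diag_block_mx mxrank1 mxrank0 addn0.
rewrite mxrankMfree ?row_free_unit ?map_modp_unitmx //.
by rewrite eqmxMfull ?row_full_unit ?map_modp_unitmx // => <-.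
Qed.

(** * Uniform matrices modulo p^n *)

Definition truncm n m k (A : 'M[Zp]_(m, k)) : 'M['I_(b ^ n)]_(m, k) :=
  map_mx (fun x => Ordinal (red_lt x n)) A.

(** Residues form a bare finite set; all computation takes place on lifts, up to [congm]. *)
Definition liftm n m k (X : 'M['I_(b ^ n)]_(m, k)) : 'M[Zp]_(m, k) :=
  map_mx (fun i : 'I_(b ^ n) => (i : nat)%:R) X.

Definition congm n m k (A B : 'M[Zp]_(m, k)) :=
  exists W, A = B + unif ^+ n *: W.

Lemma truncm_eq n m k (A B : 'M[Zp]_(m, k)) :
  truncm n A = truncm n B <-> congm n A B.
Proof.
split=> [/matrixP AB|[W ->]]; last first.
  apply/matrixP => i j; rewrite !mxE; apply: val_inj; apply/eqP.
  by change (red (B i j + unif ^+ n * W i j) n == red (B i j) n); apply/red_eqP; exists (W i j).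
have zP ij : exists z, A ij.1 ij.2 = B ij.1 ij.2 + unif ^+ n * z.
  by apply/red_eqP; have := AB ij.1 ij.2; rewrite !mxE => /(congr1 val) /= ->.
have [f fP] := choice zP.
exists (\matrix_(i, j) f (i, j)); apply/matrixP => i j.
by rewrite !mxE -(fP (i, j)).
Qed.

Lemma liftmK n m k : cancel (@liftm n m k) (@truncm n m k).
Proof.
move=> X; apply/matrixP => i j; rewrite !mxE; apply: val_inj => /=.
by rewrite red_nat modn_small.
Qed.

Lemma truncmK n m k (A : 'M[Zp]_(m, k)) : congm n (liftm (truncm n A)) A.
Proof. by apply/truncm_eq; rewrite liftmK. Qed.

Lemma congm_liftm n m k (X Y : 'M['I_(b ^ n)]_(m, k)) :
  congm n (liftm X) (liftm Y) -> X = Y.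
Proof. by move=> /truncm_eq; rewrite !liftmK. Qed.

Definition cong_inv n m k (f : 'M[Zp]_(m, k) -> bool) :=
  forall A W, f (A + unif ^+ n *: W) = f A.

(** Invariance of the uniform law: a map that is injective mod p^n permutes the finite set of
    residue matrices. *)
Lemma sum_liftm_reindex n m k (f : 'M[Zp]_(m, k) -> bool) phi :
  cong_inv n f -> (forall A B, congm n (phi A) (phi B) -> congm n A B) ->
  (\sum_(X : 'M['I_(b ^ n)]_(m, k)) f (phi (liftm X)) =
   \sum_(X : 'M['I_(b ^ n)]_(m, k)) f (liftm X))%N.
Proof.
move=> fi phii.
rewrite [RHS](reindex_inj (h := fun X => truncm n (phi (liftm X)))); last first.
  by move=> X Y /truncm_eq /phii /congm_liftm.
by apply: eq_bigr => X _; have [W ->] := truncmK n (phi (liftm X)); rewrite fi.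
Qed.

Lemma card_ordmx n m k : #|{: 'M['I_(b ^ n)]_(m, k)}| = (b ^ (n * (m * k)))%N.
Proof. by rewrite card_mx card_ord -expnM. Qed.

(** A uniform matrix mod p^(n+1) is B + p X with B uniform mod p and X uniform mod p^n,
    independently: the map is injective between sets of equal cardinality. *)
Lemma sum_liftmS n m k (f : 'M[Zp]_(m, k) -> bool) : cong_inv n.+1 f ->
  (\sum_(A : 'M['I_(b ^ n.+1)]_(m, k)) f (liftm A) =
   \sum_(B : 'M['I_(b ^ 1)]_(m, k)) \sum_(X : 'M['I_(b ^ n)]_(m, k))
      f (liftm B + unif *: liftm X)%R)%N.
Proof.
move=> fi; rewrite pair_big /=.
pose h (BX : 'M['I_(b ^ 1)]_(m, k) * 'M['I_(b ^ n)]_(m, k)) :=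
  truncm n.+1 (liftm BX.1 + unif *: liftm BX.2).
have hi : injective h.
  move=> [B X] [B' X'] /truncm_eq /= [W E].
  have BB : B = B'.
    apply: congm_liftm; exists (liftm X' + unif ^+ n *: W - liftm X).
    rewrite expr1 !scalerDr scalerA -exprS scalerN !addrA -E.
    by rewrite addrK.
  rewrite -{}BB in E *; congr (_, _); apply: congm_liftm; exists W.
  apply/matrixP => i j; have := congr1 (fun M : 'M[Zp]_(m, k) => M i j) E.
  rewrite !mxE -addrA => /addrI; rewrite exprS => /eqP.
  rewrite -subr_eq0 -mulrA -!mulrDr -mulrBr -{1}(expr1 unif) => /eqP/unif_lreg/eqP.
  by rewrite subr_eq0 => /eqP.
rewrite (reindex h) /=.
  apply: eq_bigr => -[B X] _; rewrite /h.
  by have [W ->] := truncmK n.+1 (liftm B + unif *: liftm X); rewrite fi.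
apply: onW_bij; apply: inj_card_bij => //.
by rewrite card_prod !card_ordmx -expnD mulSn mul1n.
Qed.

Definition divprofile n N (t : nat -> nat) (A : 'M[Zp]_N) : bool :=
  [forall c : 'I_n.+1, ndiv hp A c == t c].

Lemma divprofileP n N t (A : 'M[Zp]_N) :
  reflect (forall c, (c <= n)%N -> ndiv hp A c = t c) (divprofile n t A).
Proof.
apply: (iffP forallP) => [h c cn|h c]; last by rewrite h // -ltnS.
by apply/eqP/(h (Ordinal (cn : c < n.+1)%N)).
Qed.

Lemma divprofile_congm n N t (A B : 'M[Zp]_N) : congm n A B ->
  divprofile n t A = divprofile n t B.
Proof.
move=> [W AB]; apply: eq_forallb => c; rewrite (ndiv_congr hp AB) //.
by rewrite -ltnS.
Qed.

Lemma divprofile_inv n N t : cong_inv n (@divprofile n N t).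
Proof. by move=> A W; apply: divprofile_congm; exists W. Qed.

Lemma divprofile_mxequiv n N t (A B : 'M[Zp]_N) : mxequiv A B ->
  divprofile n t A = divprofile n t B.
Proof. by move=> AB; apply: eq_forallb => c; rewrite (ndiv_mxequiv hp c AB). Qed.

Lemma divprofile_block n r d t (Y : 'M[Zp]_d) : t 0%N = (r + d)%N ->
  divprofile n.+1 t (block_mx (1%:M : 'M[Zp]_r) 0 0 (unif *: Y)) =
  divprofile n (t \o succn) Y.
Proof.
move=> t0; apply/divprofileP/divprofileP => h c cn /=; last first.
  by case: c cn => [|c] cn; rewrite ?ndiv0 // ndiv_block h.
by rewrite -(ndiv_block hp r) h.
Qed.

Definition nprofile n N t : nat :=
  \sum_(X : 'M['I_(b ^ n)]_N) divprofile n t (liftm X).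

(* Eliminating the unit block [1 + p X11] turns the lower right block [X22] into
   [X22 - C], with [C] independent of [X22], so all fibres have the same size. *)
Lemma sum_schur n r d t : t 0%N = (r + d)%N ->
  (\sum_(X : 'M['I_(b ^ n)]_(r + d))
     divprofile n.+1 t (block_mx (1%:M : 'M[Zp]_r) 0 0 (0 : 'M[Zp]_d) + unif *: liftm X)%R =
   b ^ (n * (r * (r + d) + d * r)) * nprofile n d (t \o succn))%N.
Proof.
move=> t0.
pose h (uvY : ('M['I_(b ^ n)]_(r, r + d) * 'M['I_(b ^ n)]_(d, r)) * 'M['I_(b ^ n)]_d) :=
  col_mx uvY.1.1 (row_mx uvY.1.2 uvY.2).
rewrite (reindex h) /=; last first.
  exists (fun A => ((usubmx A, dlsubmx A), drsubmx A)) => [[[u v] Y]|A] _ /=.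
    by rewrite /dlsubmx /drsubmx col_mxKu col_mxKd row_mxKl row_mxKr.
  by rewrite /h /dlsubmx /drsubmx hsubmxK vsubmxK.
rewrite -(pair_bigA _ (fun uv Y => (divprofile n.+1 t
  (block_mx (1%:M : 'M[Zp]_r) 0 0 (0 : 'M[Zp]_d) + unif *: liftm (h (uv, Y))) : nat))) /=.
rewrite (eq_bigr (fun=> nprofile n d (t \o succn))) => [|[u v] _].
  by rewrite sum_nat_const card_prod !card_ordmx -expnD -mulnDr.
pose L := 1%:M + unif *: liftm (lsubmx u).
have Lu : L \in unitmx.
  apply: modp_unitmx; rewrite /L map_mxD map_mx1.
  by rewrite map_modp_unif addr0.
(* Both off-diagonal blocks carry a factor p. One stays in [C] and the other is taken out, so the
   Schur complement is p (Y - C). *)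
pose C := liftm v *m invmx L *m (unif *: liftm (rsubmx u)).
rewrite /nprofile -(@sum_liftm_reindex n d d _ (fun Y => Y - C)); first last.
- move=> A B [W E]; exists W; apply/eqP.
  by rewrite -(subrK C A) E addrAC subrK.
- exact: divprofile_inv.
apply: eq_bigr => Y _; congr nat_of_bool; rewrite -(divprofile_block _ _ t0) /h /=.
have -> : block_mx 1%:M 0 0 0 + unif *: liftm (col_mx u (row_mx v Y)) =
  block_mx L (unif *: liftm (rsubmx u)) (unif *: liftm v) (unif *: liftm Y).
  rewrite -{1}(hsubmxK u) -[col_mx _ _]/(block_mx _ _ _ _) /liftm map_block_mx.
  by rewrite scale_block_mx add_block_mx !add0r.
rewrite (divprofile_mxequiv _ _ (mxequiv_schur _ _ _ Lu)); congr divprofile.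
by rewrite scalerBr /C -!scalemxAl.
Qed.

Lemma sum_modp_ndiv n d : (d <= n)%N ->
  (\sum_(B : 'M['I_(b ^ 1)]_n) (ndiv hp (liftm B) 1 == d) = nrank 'F_p n n (n - d))%N.
Proof.
move=> dn.
pose h (B : 'M['I_(b ^ 1)]_n) := map_mx (modp hp) (liftm B).
have hi : injective h.
  move=> B B' /matrixP E; apply/matrixP => i j; apply: val_inj.
  have := E i j; rewrite !mxE /modp !red_nat !natr_modp => /(congr1 val) /=.
  have ltp (k : 'I_(b ^ 1)) : (k < p)%N.
    by apply: leq_trans (ltn_ord k) _; rewrite expn1 base_prime.
  by rewrite !val_Fp_nat // !modn_small.
rewrite /nrank -sum1_card [RHS]big_mkcond [RHS](reindex h) /=; last first.
  apply: onW_bij; apply: inj_card_bij => //.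
  by rewrite card_ordmx card_mx card_Fp // mul1n base_prime.
apply: eq_bigr => B _; rewrite inE.
have := rank_modp (liftm B); rewrite -/(h B) => E.
have -> : (\rank (h B) == n - d)%N = (ndiv hp (liftm B) 1 == d).
  by move: dn E; move: (\rank _) (ndiv _ _ _) => rk nd; lia.
by case: (_ == _).
Qed.

(** Fix the residue B mod p, of corank [t 1]. If U B V = diag(I, p Y), then U (B + p X) V = diag(I,
    0) + p (diag(0, Y) + U X V), and the last bracket is again uniform mod p^n. The power of [b]
    counts the free entries outside the lower right block. *)
Lemma nprofileS n N t : t 0%N = N -> (t 1 <= N)%N ->
  nprofile n.+1 N t =
  (nrank 'F_p N N (N - t 1) * (b ^ (n * (N * N - t 1 * t 1)) *
   nprofile n (t 1) (t \o succn)))%N.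
Proof.
move=> t0 t1; rewrite -sum_modp_ndiv // big_distrl /=.
rewrite {1}/nprofile sum_liftmS; last exact: divprofile_inv.
apply: eq_bigr => B _.
have [Bd|Bd] := eqVneq (ndiv hp (liftm B) 1) (t 1); last first.
  (* T_1 depends on B alone, so no lift of such a B has the profile. *)
  rewrite mul0n big1 // => X _; apply/eqP; rewrite eqb0.
  apply: contra Bd => /divprofileP/(_ 1%N isT) <-; apply/eqP.
  by symmetry; apply: (@ndiv_congr _ hp _ _ _ (liftm X) 1) => //; rewrite expr1.
rewrite mul1n; move: t0 t1 Bd; move: (t 1%N) => d /[swap] dN.
have [r rd] : exists r, N = (r + d)%N by exists (N - d)%N; rewrite subnK.
subst N => t0 Bd.
have -> : (n * ((r + d) * (r + d) - d * d) = n * (r * (r + d) + d * r))%N.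
  by congr (_ * _)%N; rewrite mulnDl (mulnDr d) addnA addnK.
apply: etrans (sum_schur n t0).
have [Y [U [V [Uu Vu E]]]] := ndiv1_block Bd.
pose Y' : 'M[Zp]_(r + d) := block_mx 0 0 0 Y.
pose I := block_mx (1%:M : 'M[Zp]_r) 0 0 (0 : 'M[Zp]_d).
pose f Z := divprofile n.+1 t (I + unif *: Z).
apply: etrans (@sum_liftm_reindex n _ _ f (fun X => Y' + U *m X *m V) _ _); first last.
- move=> A A' [W] /eqP; rewrite -addrA => /eqP/addrI EA.
  exists (invmx U *m W *m invmx V).
  have := congr1 (fun M => invmx U *m M *m invmx V) EA.
  rewrite mulmxDr mulmxDl -!mulmxA !mulmxV // !mulmx1 !mulmxA !mulVmx // !mul1mx.
  by rewrite -scalemxAr -scalemxAl.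
- move=> A W; apply: divprofile_congm; exists W.
  by rewrite scalerDr scalerA -exprS addrA.
apply: eq_bigr => X _.
apply: (congr1 nat_of_bool).
rewrite /f.
apply: divprofile_mxequiv.
exists U, V; split=> //.
rewrite mulmxDr mulmxDl -E -scalemxAr -scalemxAl scalerDr addrA; congr (_ + _).
by rewrite /I /Y' scale_block_mx add_block_mx !scaler0 !addr0 add0r.
Qed.

Lemma ndiv_le n (A : 'M[Zp]_n) c : (ndiv hp A c <= n)%N.
Proof.
have [lam [_ Alam]] := smith_form hp A; rewrite (ndiv_equiv hp c Alam).
rewrite /ngeo -[X in (_ <= X)%N]card_ord -sum1_card; apply: leq_sum => i _.
exact: leq_b1.
Qed.

(** At each step, the number of square matrices over F_p of size d and corank d' is p^(d^2) P^(0)(d,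
    d'). *)
Lemma nprofileE (R : realType) n N t : t 0%N = N ->
  (nprofile n N t)%:R =
  p%:R ^+ (n * (N * N)) * \prod_(i < n) Pker p 0 (t i) (t i.+1) :> R.
Proof.
elim: n => [|n IH] in N t *.
  move=> t0; rewrite big_ord0 mulr1 /nprofile.
  rewrite (eq_bigr (fun=> 1%N)) => [|X _].
    by rewrite sum_nat_const card_ordmx !mul0n.
  by have -> // : divprofile 0 t (liftm X); apply/divprofileP => -[|//] _; rewrite ndiv0.
move=> t0; rewrite big_ord_recl /=.
(* An upward first step is never realised, and there [Pker] takes its default value 0. *)
have [t1|t1] := leqP (t 1) N; last first.
  rewrite /Pker t0 leqNgt t1 /= mul0r mulr0 /nprofile big1 // => X _.
  apply/eqP; rewrite eqb0; apply/negP => /divprofileP/(_ 1%N isT) E.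
  by have := ndiv_le (liftm X) 1; rewrite E leqNgt t1.
rewrite nprofileS // !natrM (IH (t 1)) //=.
rewrite natrX [(base p)%:R](congr1 (fun k => k%:R) (base_prime hp)) !mulrA -[X in X * _ = _]mulrA -exprD.
have le2 : (t 1 * t 1 <= N * N)%N by rewrite leq_mul.
rewrite -mulnDr subnK //; congr (_ * _).
have [r rd] : exists r, N = (r + t 1)%N by exists (N - t 1)%N; rewrite subnK.
rewrite mulSn exprD /Pker t0 t1 rd addnK.
set d := t 1.
have p0 : 0 < p%:R :> R by rewrite ltr0n prime_gt0.
have paE : pa p 0 = Defs.pinv R p by rewrite /pa subr0 powR_inv1 // ltW.
rewrite paE mul0r subr0.
have -> : p%:R `^ (- d%:R ^+ 2) = Defs.pinv R p ^+ (d * d) :> R.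
  by rewrite powRN -natrX powR_mulrn ?(ltW p0) // exprVn mulnn.
have t01 : 0 < Defs.pinv R p < 1.
  by rewrite invr_gt0 p0 invf_lt1 // ltr1n prime_gt1.
have qn0 k : qpoch (Defs.pinv R p) (Defs.pinv R p) k != 0.
  by case/andP: (t01) => a0 a1; rewrite gt_eqF // qpoch_gt0.
have := @nrankE 'F_p R (Defs.pinv R p) d d r.
rewrite card_Fp // => /(_ erefl) E.
apply: (mulIf (mulf_neq0 (mulf_neq0 (qn0 d) (qn0 d)) (qn0 r))).
rewrite mulrAC (addnC r d) E /Defs.pinv invrK mulrC; rewrite /Defs.pinv in qn0.
by field; rewrite !qn0.
Qed.

End Counting.

(** * Comparison with digit expansions *)

Section Embedding.
Variable p : nat.
Local Notation Zp := (padic p).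
Local Notation unif := (unif p).
Local Notation b := (base p).
Local Notation q := ((base p)%:R : rat).

Lemma qp_eqP (X Y : qp p) : (forall n, qdig X n = qdig Y n) -> X = Y.
Proof.
case: X Y => [f f1 f2] [g g1 g2] /= /funext fg; rewrite fg in f1 f2 *.
by congr Qp; exact: Prop_irrelevance.
Qed.

(** Position n of p^(-M) x holds the digit i = n + M of x, the quotient of x mod [b ^ i.+1] by
    [b ^ i]; positions below -M are 0. *)
Definition iota_dig (M : nat) (x : Zp) (n : int) : nat :=
  if (n + M%:Z)%R is Posz i then (red x i.+1 %/ b ^ i)%N else 0%N.

Lemma iota_dig_lt M x n : (iota_dig M x n < b)%N.
Proof.
rewrite /iota_dig; case: (n + _)%R => [i|//]; last by rewrite base_gt0.
by rewrite ltn_divLR ?expb_gt0 // -expnS red_lt.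
Qed.

Lemma iota_dig_bdd M x : exists L : int, forall n, n < L -> iota_dig M x n = 0%N.
Proof.
exists (- M%:Z) => n; rewrite /iota_dig.
by case E : (n + M%:Z) => [i|//] nM; lia.
Qed.

(* [p ^ - M * x] as an element of Q_p. *)
Definition piota M x : qp p := Qp (iota_dig_lt M x) (iota_dig_bdd M x).

Lemma piota_dig M x i : qdig (piota M x) (i%:Z - M%:Z) = (red x i.+1 %/ b ^ i)%N.
Proof. by rewrite /= /iota_dig subrK. Qed.

Lemma piota_dig_low M x n : n < - M%:Z -> qdig (piota M x) n = 0%N.
Proof. by move=> nM; rewrite /= /iota_dig; case E : (n + M%:Z) => [i|//]; lia. Qed.

Lemma int_shift_case (M : nat) (n : int) :
  (exists i : nat, n = i%:Z - M%:Z) \/ (exists e : nat, n = - M%:Z - e.+1%:Z).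
Proof.
case E : (n + M%:Z) => [i|e]; first by left; exists i; lia.
by right; exists e; lia.
Qed.

Lemma redS_dig (x : Zp) n : (red x n.+1 = red x n + (red x n.+1 %/ b ^ n) * b ^ n)%N.
Proof. by rewrite {1}(divn_eq (red x n.+1) (b ^ n)) addnC red_mod. Qed.

Lemma piota_eq_dig M x y m :
  red x m = red y m <->
  (forall n, n < m%:Z - M%:Z -> qdig (piota M x) n = qdig (piota M y) n).
Proof.
split=> [xy n nm|].
  have [[i E]|[e E]] := int_shift_case M n; last by rewrite !piota_dig_low //; lia.
  rewrite E !piota_dig; congr (_ %/ _)%N.
  have im : (i < m)%N by lia.
  by rewrite -!(red_mod _ im) xy.
elim: m => [|m IH] h; first by rewrite !red0.
rewrite (redS_dig x) (redS_dig y) IH => [|n nm]; last by apply: h; lia.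
by rewrite -!(piota_dig M) h //; lia.
Qed.

Lemma piota_inj M : injective (piota M).
Proof. by move=> x y E; apply: padicP => m; apply/(piota_eq_dig M) => n _; rewrite E. Qed.

Lemma piota_low_red M x m :
  (forall n, n < m%:Z - M%:Z -> qdig (piota M x) n = 0%N) -> red x m = 0%N.
Proof.
elim: m => [|m IH] h; first by rewrite red0.
rewrite redS_dig IH => [|n nm]; last by apply: h; lia.
by rewrite -(piota_dig M) h //; lia.
Qed.

Lemma piota_surj M (X : qp p) :
  (forall n, n < - M%:Z -> qdig X n = 0%N) -> exists x, X = piota M x.
Proof.
move=> X0; pose f n := (\sum_(i < n) qdig X (i%:Z - M%:Z) * b ^ i)%N.
have fS n : f n.+1 = (f n + qdig X (n%:Z - M%:Z) * b ^ n)%N.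
  by rewrite /f big_ord_recr.
have flt n : (f n < b ^ n)%N.
  elim: n => [|n IH]; first by rewrite /f big_ord0.
  rewrite fS expnS; apply: (@leq_trans (b ^ n + qdig X (n%:Z - M%:Z) * b ^ n)).
    by rewrite ltn_add2r.
  by rewrite -mulSn leq_mul2r qdig_lt orbT.
have fP n : (f n.+1 = f n %[mod b ^ n])%N by rewrite fS addnC modnMDl.
exists (padic_lim fP); apply: qp_eqP => n.
have [[i ->]|[e E]] := int_shift_case M n; last by rewrite piota_dig_low ?X0 //; lia.
rewrite piota_dig /= modn_small // fS divnDMl ?expb_gt0 // divn_small ?add0n //.
Qed.

Lemma qp_piota (X : qp p) : exists M0, forall M, (M0 <= M)%N -> exists x, X = piota M x.
Proof.
have [L hL] := qdig_bdd X; exists `|L|%N => M LM; apply: piota_surj => n nM.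
by apply: hL; lia.
Qed.

Lemma qlow_low (X : qp p) n : n < qlow X -> qdig X n = 0%N.
Proof. by rewrite /qlow; case: cid => L /= h; apply: h. Qed.

Lemma qtrunc_eq0 (X : qp p) m : (forall n, n < m -> qdig X n = 0%N) -> qtrunc X m = 0.
Proof.
move=> X0; rewrite /qtrunc big_nat_cond big1 // => i /andP[/andP[_ im] _].
by rewrite X0 ?mul0r //; move: im; case: ifP => //; lia.
Qed.

(** Removes the dependence on [qlow], an arbitrary bound obtained by choice: below it the digit and
    both truncations vanish. *)
Lemma qtruncS (X : qp p) m : qtrunc X (m + 1) = qtrunc X m + (qdig X m)%:R * q ^ m.
Proof.
have [mL|Lm] := ltP m (qlow X).
  rewrite !qtrunc_eq0 ?qlow_low ?mul0r ?addr0 // => n nm; apply: qlow_low; lia.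
rewrite /qtrunc ltzD1 Lm.
have -> : absz (m + 1 - qlow X)%R = (absz (m - qlow X)%R).+1 by lia.
rewrite big_nat_recr //=; congr (_ + _).
  have -> // : (if qlow X < m then absz (m - qlow X)%R else 0%N) = absz (m - qlow X)%R.
  by case: ifP => //; lia.
by have -> : qlow X + (absz (m - qlow X)%R)%:Z = m by lia.
Qed.

Lemma q_neq0 : q != 0.
Proof. by rewrite pnatr_eq0 -lt0n base_gt0. Qed.

Lemma qtrunc_piota M x j :
  qtrunc (piota M x) (j%:Z - M%:Z) = (red x j)%:R / q ^+ M.
Proof.
elim: j => [|j IH].
  rewrite red0 mul0r qtrunc_eq0 // => n nM; apply: piota_dig_low; lia.
have -> : j.+1%:Z - M%:Z = j%:Z - M%:Z + 1 by lia.
rewrite qtruncS IH piota_dig [in RHS]redS_dig natrD natrM natrX mulrDl; congr (_ + _).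
by rewrite expfzDr ?q_neq0 // mulrA -exprnN.
Qed.

Lemma rdigit_div (k M i : nat) :
  rdigit p (k%:R / q ^+ M) (i%:Z - M%:Z) = ((k %/ b ^ i) %% b)%N.
Proof.
rewrite /rdigit expfzDr ?q_neq0 // -exprnN invfM invrK.
have -> : k%:R / q ^+ M * (q ^- i * q ^+ M) = k%:R / q ^+ i.
  by rewrite mulrCA mulfVK ?expf_neq0 ?q_neq0 // mulrC.
have -> : Num.floor (k%:R / q ^+ i) = (k %/ b ^ i)%N%:Z.
  have q0 : 0 < q ^+ i by rewrite exprn_gt0 // ltr0n base_gt0.
  apply: floor_def; rewrite ler_pdivlMr // ltr_pdivrMr // -natrX.
  have -> : (k %/ b ^ i)%N%:Z + 1 = (k %/ b ^ i).+1%:Z by lia.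
  rewrite -!pmulrn -!natrM ler_nat ltr_nat.
  by rewrite leq_divM ltn_ceil ?expb_gt0.
by rewrite modz_nat.
Qed.

(** Below position -M the scaled number is an integer multiple of the base. *)
Lemma rdigit_low (k M e : nat) : rdigit p (k%:R / q ^+ M) (- M%:Z - e.+1%:Z) = 0%N.
Proof.
rewrite /rdigit -opprD -PoszD -exprnN invrK exprD mulrA mulfVK ?expf_neq0 ?q_neq0 //.
rewrite -natrX -natrM -[(k * _)%N%:R]/((k * b ^ e.+1)%N%:Z%:~R) intrKfloor.
by rewrite modz_nat expnSr mulnA modnMl.
Qed.

Lemma qmk_eq (f : int -> nat) X : (forall n, f n = qdig X n) -> qmk p f = X.
Proof.
move=> fX; rewrite /qmk; case: pselect => [h|[]]; last first.
  by have [L hL] := qdig_bdd X; exists L => n nL; rewrite fX hL.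
by apply: qp_eqP => n /=; rewrite fX modn_small // qdig_lt.
Qed.

Lemma qadd_piota M x y : qadd (piota M x) (piota M y) = piota M (x + y).
Proof.
apply: qmk_eq => n; have [[i ->]|[e E]] := int_shift_case M n; last first.
  rewrite piota_dig_low; last by lia.
  rewrite !qtrunc_eq0 => [|j jn|j jn]; try by apply: piota_dig_low; lia.
  by rewrite addr0 -(mul0r (q ^+ M)^-1) E (rdigit_low 0).
have -> : i%:Z - M%:Z + 1 = i.+1%:Z - M%:Z by lia.
rewrite !qtrunc_piota -mulrDl -natrD rdigit_div piota_dig redD.
by rewrite modn_divl -expnS.
Qed.

(** Cutting x after a digits and y after a' digits changes the product by p^a u y + p^a' x v -
    p^(a+a') u v. The K of [qmul] is large enough for p^(i+1) to divide each term, once the powers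
    of p known to divide x and y are taken into account. *)
Lemma qmul_piota M M' x y :
  qmul (piota M x) (piota M' y) = piota (M + M') (x * y).
Proof.
apply: qmk_eq => n /=.
set X := piota M x; set Y := piota M' y.
set K : int := _ - Num.min (qlow Y) 0.
pose K' := `|K|%N.
have KE : K = K'%:Z by rewrite /K' /K; lia.
pose a := (K' + M)%N; pose a' := (K' + M')%N.
have -> : qtrunc X K = (red x a)%:R / q ^+ M.
  by rewrite -qtrunc_piota -/X; congr qtrunc; rewrite KE /a; lia.
have -> : qtrunc Y K = (red y a')%:R / q ^+ M'.
  by rewrite -qtrunc_piota -/Y; congr qtrunc; rewrite KE /a'; lia.
have -> : (red x a)%:R / q ^+ M * ((red y a')%:R / q ^+ M') =
    (red x a * red y a')%N%:R / q ^+ (M + M').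
  by rewrite mulrACA -natrM -invfM -exprD.
have [[i E]|[e ->]] := int_shift_case (M + M') n; last first.
  by rewrite rdigit_low -[LHS](@piota_dig_low (M + M') (x * y) (- (M + M')%:Z - e.+1%:Z)) //; lia.
rewrite {1}E rdigit_div.
transitivity (qdig (piota (M + M') (x * y)) n); last by [].
rewrite E piota_dig modn_divl -expnS; congr (_ %/ _)%N.
have [u xE] : exists u, x = (red x a)%:R + unif ^+ a * u.
  by apply/red_eqP; rewrite red_nat red_modn.
have [v yE] : exists v, y = (red y a')%:R + unif ^+ a' * v.
  by apply/red_eqP; rewrite red_nat red_modn.
(* p^lx divides x because the digits of [X] below [qlow X] vanish; 0 is the trivial exponent when
   [qlow X] lies below -M. *)
pose lx := (if (qlow X + M%:Z) is Posz j then j else 0%N).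
pose ly := (if (qlow Y + M'%:Z) is Posz j then j else 0%N).
have [x' xlE] : exists x', x = unif ^+ lx * x'.
  apply/red_eq0P/eqP/(@piota_low_red M) => j; rewrite /lx.
  case El : (qlow X + M%:Z) => [k|k] jk; last by apply: piota_dig_low; lia.
  by apply: qlow_low; rewrite -/X; lia.
have [y' ylE] : exists y', y = unif ^+ ly * y'.
  apply/red_eq0P/eqP/(@piota_low_red M') => j; rewrite /ly.
  case El : (qlow Y + M'%:Z) => [k|k] jk; last by apply: piota_dig_low; lia.
  by apply: qlow_low; rewrite -/Y; lia.
have h1 : (i.+1 <= a + ly)%N.
  rewrite /ly /a; move: KE; rewrite /K.
  by case El : (qlow Y + M'%:Z) => [k|k]; lia.
have h2 : (i.+1 <= a' + lx)%N.
  rewrite /lx /a'; move: KE; rewrite /K.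
  by case El : (qlow X + M%:Z) => [k|k]; lia.
have h3 : (i.+1 <= a + a')%N by rewrite /a /a'; move: KE; rewrite /K; lia.
transitivity (red ((red x a)%:R * (red y a')%:R : Zp) i.+1).
  by rewrite redM !red_nat modnMm.
apply/eqP/red_eqP.
(* The three error terms divided by p^(i+1); [h1], [h2] and [h3] make the truncated subtractions
   exact. *)
exists (unif ^+ (a + a' - i.+1) * u * v - unif ^+ (a + ly - i.+1) * u * y'
        - unif ^+ (a' + lx - i.+1) * x' * v).
have xa : (red x a)%:R = x - unif ^+ a * u.
  by apply/eqP; rewrite eq_sym subr_eq -xE.
have ya : (red y a')%:R = y - unif ^+ a' * v.
  by apply/eqP; rewrite eq_sym subr_eq -yE.
rewrite !mulrBr !mulrA -!exprD !subnKC //.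
rewrite (exprD unif a a') (exprD unif a ly) (exprD unif a' lx) xa ya.
transitivity (x * y + unif ^+ a * u * (unif ^+ a' * v)
   - unif ^+ a * u * (unif ^+ ly * y') - unif ^+ a' * (unif ^+ lx * x') * v).
  by rewrite -xlE -ylE; ring.
ring.
Qed.

Lemma qpow_piota M (m : int) : 0 <= m + M%:Z ->
  qpow p m = piota M (unif ^+ absz (m + M%:Z)%R).
Proof.
move=> mM; apply: qmk_eq => n; have [[i E]|[e E]] := int_shift_case M n; last first.
  by rewrite piota_dig_low; last lia; have -> : (n == m) = false by lia.
rewrite E piota_dig /unif -natrX red_nat.
set k := absz _; have -> : (i%:Z - M%:Z == m) = (i == k)%N by rewrite /k; lia.
have [ik|ik|->] := ltngtP i k.
- by rewrite -(subnKC ik) expnD modnMr div0n.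
- by rewrite modn_small ?divn_small ?ltn_exp2l ?base_gt1 //; apply: ltnW.
- by rewrite modn_small ?ltn_exp2l ?base_gt1 // divnn expb_gt0.
Qed.

Lemma qzero_piota M : qzero p = piota M 0.
Proof.
apply: qp_eqP => n; have [[i ->]|[e E]] := int_shift_case M n.
  by rewrite piota_dig /= mod0n div0n.
by rewrite piota_dig_low //; lia.
Qed.

Lemma qone_piota : qone p = piota 0 1.
Proof. by rewrite /qone (@qpow_piota 0). Qed.

Lemma qsum_piota (I : Type) M (s : seq I) (F : I -> Zp) :
  qsum [seq piota M (F i) | i <- s] = piota M (\sum_(i <- s) F i).
Proof.
elim: s => [|i s IH] /=; first by rewrite big_nil -qzero_piota.
by rewrite big_cons -qadd_piota -IH.
Qed.

(** Allows elements written with different M to be compared at a common one. *)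
Lemma piota_unifM M k x : piota (M + k) (unif ^+ k * x) = piota M x.
Proof.
apply: qp_eqP => n; have [[i ->]|[e E]] := int_shift_case M n; last first.
  rewrite [RHS]piota_dig_low; last by lia.
  have [[i E']|[e' E']] := int_shift_case (M + k) n; last by rewrite piota_dig_low //; lia.
  have /red_eq0P/eqP r0 : exists z, unif ^+ k * x = unif ^+ i.+1 * z.
    exists (unif ^+ (k - i.+1) * x); rewrite mulrA -exprD subnKC //; lia.
  by rewrite E' piota_dig r0 div0n.
have {1}-> : i%:Z - M%:Z = (k + i)%N%:Z - (M + k)%N%:Z by lia.
by rewrite !piota_dig -addnS redXM expnD divnMl ?expb_gt0.
Qed.

End Embedding.

(** * Matrices over Q_p as scaled integral matrices, and their singular numbers *)

Section MatrixEmbedding.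
Variables (p N : nat).
Local Notation Zp := (padic p).
Local Notation unif := (unif p).

Definition miota M (A : 'M[Zp]_N) : MatQp p N := \matrix_(i, j) piota M (A i j).

Lemma miota_inj M : injective (miota M).
Proof.
move=> A B /matrixP AB; apply/matrixP => i j; apply: (@piota_inj p M).
by have := AB i j; rewrite !mxE.
Qed.

Lemma miota_unif M k A : miota (M + k) (unif ^+ k *: A) = miota M A.
Proof. by apply/matrixP => i j; rewrite !mxE piota_unifM. Qed.

Lemma madd_miota M A B : madd (miota M A) (miota M B) = miota M (A + B).
Proof. by apply/matrixP => i j; rewrite !mxE qadd_piota. Qed.

Lemma mmul_miota M M' A B : mmul (miota M A) (miota M' B) = miota (M + M') (A *m B).
Proof.
apply/matrixP => i j; rewrite !mxE.
rewrite (eq_map (g := fun k => piota (M + M') (A i k * B k j))); last first.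
  by move=> k; rewrite !mxE qmul_piota.
by rewrite (qsum_piota _ _ (fun k => A i k * B k j)) big_enum.
Qed.

Lemma miota_surj M (Z : MatQp p N) :
  (forall i j n, n < - M%:Z -> qdig (Z i j) n = 0%N) -> exists A, Z = miota M A.
Proof.
move=> Z0; have zP ij : exists x, Z ij.1 ij.2 = piota M x.
  by apply: piota_surj => n; apply: Z0.
have [f fP] := choice zP; exists (\matrix_(i, j) f (i, j)).
by apply/matrixP => i j; rewrite !mxE -(fP (i, j)).
Qed.

Lemma mat_miota (Z : MatQp p N) :
  exists M0, forall M, (M0 <= M)%N -> exists A, Z = miota M A.
Proof.
have lP (ij : 'I_N * 'I_N) := qp_piota (Z ij.1 ij.2).
have [f fP] := choice lP; exists (\max_ij f ij) => M hM.
apply: miota_surj => i j n nM.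
have [|x /= ->] := fP (i, j) M; last exact: piota_dig_low.
by apply: leq_trans hM; apply: leq_bigmax.
Qed.

Lemma mintP (Z : MatQp p N) : mint Z <-> exists A, Z = miota 0 A.
Proof.
split=> [Zi|[A ->] i j n n0]; last by rewrite mxE piota_dig_low.
by apply: miota_surj => i j n n0; apply: Zi.
Qed.

Lemma mone_miota : mone p N = miota 0 1%:M.
Proof.
apply/matrixP => i j; rewrite !mxE; case: eqP => _; first exact: qone_piota.
exact: qzero_piota.
Qed.

Lemma inGLP (B : MatQp p N) :
  inGL B <-> exists2 U : 'M[Zp]_N, U \in unitmx & B = miota 0 U.
Proof.
split=> [[/mintP[U ->] [B' [/mintP[V ->] []]]]|[U Uu ->]].
  rewrite mmul_miota mone_miota => /miota_inj UV _; exists U => //.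
  by have [] := mulmx1_unit UV.
split; first by apply/mintP; exists U.
exists (miota 0 (invmx U)); split; first by apply/mintP; exists (invmx U).
by rewrite !mmul_miota mulmxV // mulVmx // mone_miota.
Qed.

Definition singbnd M (k : 'I_N -> option int) : Prop :=
  forall i m, k i = Some m -> m <= M%:Z.

(** The Smith exponents M - k_i of p^M Z for Z with singular numbers k, with -oo sent to +oo. Under
    [singbnd] the difference is nonnegative and [absz] loses nothing. *)
Definition singexp M (k : 'I_N -> option int) (i : 'I_N) : option nat :=
  omap (fun m => absz (M%:Z - m)%R) (k i).

Lemma sdiag_miota M k : singbnd M k ->
  sdiag p k = miota M (udiag p (singexp M k)).
Proof.
move=> kM; apply/matrixP => i j; rewrite !mxE /singexp.
case: eqP => [->|_]; last by rewrite mulr0n -qzero_piota.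
rewrite mulr1n; case kj : (k j) => [m|] /=; last exact: qzero_piota.
have mM := kM _ _ kj.
rewrite (@qpow_piota p M); last by lia.
by congr (piota _ (_ ^+ absz _)); lia.
Qed.

Lemma is_sing_miota M k (Z : MatQp p N) : singbnd M k ->
  is_sing Z k <-> exists2 A, Z = miota M A & mxequiv A (udiag p (singexp M k)).
Proof.
move=> kM; split=> [[B [C [/inGLP[U Uu ->] [/inGLP[V Vu ->]]]]]|[A ->]].
  rewrite (sdiag_miota kM) !mmul_miota addn0 add0n => ->.
  exists (U *m udiag p (singexp M k) *m V) => //.
  by apply: mxequiv_sym; exists U, V.
move=> /mxequiv_sym[U [V [Uu Vu ->]]].
exists (miota 0 U), (miota 0 V); split; first by apply/inGLP; exists U.
split; first by apply/inGLP; exists V.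
by rewrite (sdiag_miota kM) !mmul_miota addn0.
Qed.

Lemma singexp_sorted M k : inDelta k -> singbnd M k -> sortedo (singexp M k).
Proof.
move=> kd kM i j /kd; rewrite /singexp.
case ki : (k i) => [a|]; case kj : (k j) => [c|] //= ca.
by have := kM _ _ ki; have := kM _ _ kj; lia.
Qed.

Lemma singexp_inj M k k' : singbnd M k -> singbnd M k' ->
  singexp M k = singexp M k' -> k = k'.
Proof.
move=> kM kM' E; apply/funext => i; have := congr1 (fun f => f i) E.
rewrite /singexp.
case ki : (k i) => [a|]; case ki' : (k' i) => [c|] //= [].
by have := kM _ _ ki; have := kM' _ _ ki' => ? ? ?; congr Some; lia.
Qed.

Lemma singbndW M M' k : (M <= M')%N -> singbnd M k -> singbnd M' k.
Proof. by move=> MM kM i m /kM; lia. Qed.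

Lemma singexpD M e k : singbnd M k ->
  singexp (M + e) k = fun i => omap (addn e) (singexp M k i).
Proof.
move=> kM; apply/funext => i; rewrite /singexp.
by case ki : (k i) => [a|] //=; have := kM _ _ ki => ?; congr Some; lia.
Qed.

Lemma singbnd_ex k : exists M, singbnd M k.
Proof.
exists (\max_i (if k i is Some m then absz m else 0%N)) => i m ki.
have := @leq_bigmax _ (fun i => if k i is Some m then absz m else 0%N) i.
by rewrite ki; lia.
Qed.

Hypothesis hp : prime p.

(** A Smith form of p^M Z, for M large, supplies singular numbers, so [Sing] never takes its default
    value. *)
Lemma Sing_is_sing (Z : MatQp p N) : inDelta (Sing Z) /\ is_sing Z (Sing Z).
Proof.
rewrite /Sing; case: pselect => [h|[]]; first by case: cid.
have [M /(_ M (leqnn M)) [A ->]] := mat_miota Z.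
have [lam [ls Alam]] := smith_form hp A.
pose k i := omap (fun l : nat => M%:Z - l%:Z) (lam i).
have kM : singbnd M k by move=> i m; rewrite /k; case: (lam i) => //= l [<-]; lia.
exists k; split.
  by move=> i j /ls; rewrite /k; case: (lam i) (lam j) => [a|] [c|] //=; lia.
apply/(is_sing_miota _ kM); exists A => //.
suff -> : singexp M k = lam by [].
apply/funext => i; rewrite /singexp /k; case: (lam i) => //= l; congr Some; lia.
Qed.

(** The T_c determine k, which also settles the choice made in [Sing]. In the converse the chosen
    singular numbers have their own bound M', unrelated to M, so the comparison is made at level M +
    M'. *)
Lemma SingP M k (Z : MatQp p N) : inDelta k -> singbnd M k ->
  Sing Z = k <-> exists2 A, Z = miota M A &
                   forall c, ndiv hp A c = ngeo (singexp M k) c.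
Proof.
move=> kd kM; split=> [Zk|[A ZA Ak]].
  have [_] := Sing_is_sing Z; rewrite Zk => /(is_sing_miota _ kM)[A ZA Ak].
  by exists A => // c; apply: ndiv_equiv.
have [k'd Zk'] := Sing_is_sing Z; have [M' k'M'] := singbnd_ex (Sing Z).
move: (Sing Z) k'd Zk' k'M' => k' k'd Zk' k'M'.
have k'M := singbndW (leq_addl M M') k'M'.
have /(is_sing_miota _ k'M)[A' ZA' A'k] := Zk'.
have AA : unif ^+ M' *: A = A' by apply: (@miota_inj (M + M')); rewrite miota_unif -ZA.
apply/esym; apply: (singexp_inj (singbndW (leq_addr M' M) kM) k'M).
apply: sortedo_ngeo_inj => [||c].
- exact: singexp_sorted (singbndW (leq_addr M' M) kM).
- exact: singexp_sorted.
by rewrite -(ndiv_equiv hp c A'k) -AA ndivZ Ak (singexpD _ kM) ngeo_addn.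
Qed.

End MatrixEmbedding.

(** * Haar volumes *)

Lemma measure_big_uniq d (T : measurableType d) (R : realType)
    (mu : {measure set T -> \bar R}) (I : choiceType) (r : seq I) (F : I -> set T) :
  uniq r -> (forall i, measurable (F i)) -> trivIset setT F ->
  mu (\big[setU/set0]_(i <- r) F i) = (\sum_(i <- r) mu (F i))%E.
Proof.
move=> ur mF tF; rewrite -bigcup_seq measure_fin_bigcup -?fsbig_seq //.
exact: sub_trivIset tF.
Qed.

Section Volume.
Variables (R : realType) (p N : nat).
Local Notation Zp := (padic p).
Local Notation unif := (unif p).
Local Notation b := (base p).

Definition miotaset M (f : 'M[Zp]_N -> bool) : set (MatQpMeas p N) :=
  [set Z | exists2 A, Z = miota M A & f A].

Definition qball (Z : MatQp p N) m : set (MatQpMeas p N) := mball Z m.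

Lemma qball_miota M n (A : 'M[Zp]_N) :
  qball (miota M A) (n%:Z - M%:Z) = [set Z | exists2 B, Z = miota M B & congm n B A].
Proof.
apply/seteqP; split=> [Z hZ|_ [B -> /truncm_eq/matrixP BA] i j m mn]; last first.
  rewrite !mxE; apply: (iffLR (piota_eq_dig M (B i j) (A i j) n)) mn.
  by have := BA i j; rewrite !mxE => /(congr1 val).
have [B ZB] : exists B, Z = miota M B.
  apply: miota_surj => i j m mM; rewrite hZ ?mxE ?piota_dig_low //; lia.
exists B => //; apply/truncm_eq/matrixP => i j; rewrite !mxE; apply: val_inj => /=.
apply/(piota_eq_dig M) => m mn.
by have := hZ i j m mn; rewrite ZB !mxE.
Qed.

Lemma measurable_qball Z m : measurable (qball Z m).
Proof. by apply: sub_sigma_algebra; exists Z, m. Qed.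

Lemma miotaset_bigsetU M n f : cong_inv n f ->
  miotaset M f = \big[setU/set0]_(X <- [seq X <- index_enum 'M['I_(b ^ n)]_N | f (liftm X)])
    qball (miota M (liftm X)) (n%:Z - M%:Z).
Proof.
move=> fi; rewrite -bigcup_seq; apply/seteqP; split=> [_ [A -> fA]|Z [X]].
  have [W AW] := truncmK n A.
  have XA : truncm n A \in [seq X <- index_enum 'M['I_(b ^ n)]_N | f (liftm X)].
    by rewrite mem_filter mem_index_enum AW fi fA.
  exists (truncm n A); first exact: XA.
  by rewrite qball_miota; exists A => //; apply/truncm_eq; rewrite liftmK.
move=> XA; have : X \in [seq X <- index_enum 'M['I_(b ^ n)]_N | f (liftm X)] := XA.
rewrite mem_filter => /andP[fX _]; rewrite qball_miota => -[B -> [W BX]].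
by exists B => //; rewrite BX fi.
Qed.

Lemma measurable_miotaset M n f : cong_inv n f -> measurable (miotaset M f).
Proof.
move=> /(miotaset_bigsetU M) ->; apply: bigsetU_measurable => X _.
exact: measurable_qball.
Qed.

Variable vol : {measure set (MatQpMeas p N) -> \bar R}.
Hypothesis vol_inv : forall (A : MatQp p N) (S : set (MatQpMeas p N)),
  measurable S -> vol (mtranslate A @` S) = vol S.
Hypothesis vol_norm : vol (@MatZp p N) = 1%E.

Lemma vol_qball M n (A : 'M[Zp]_N) :
  vol (qball (miota M A) (n%:Z - M%:Z)) = vol (qball (miota M 0) (n%:Z - M%:Z)).
Proof.
rewrite -[RHS](vol_inv (miota M A)); last exact: measurable_qball.
congr (vol _); rewrite !qball_miota; apply/seteqP; split=> [_ [B -> [W ->]]|_ [_ [B -> [W ->]] <-]].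
  exists (miota M (unif ^+ n *: W)); last by rewrite /mtranslate madd_miota.
  by exists (unif ^+ n *: W) => //; exists W; rewrite add0r.
exists (A + unif ^+ n *: W); last by exists W.
by rewrite /mtranslate madd_miota add0r.
Qed.

Lemma vol_miotaset_ball M n f : cong_inv n f ->
  vol (miotaset M f) =
  ((\sum_(X : 'M['I_(b ^ n)]_N) f (liftm X))%:R%:E *
   vol (qball (miota M 0) (n%:Z - M%:Z)))%E.
Proof.
move=> fi; rewrite (miotaset_bigsetU M fi) measure_big_uniq; first last.
- apply/trivIsetP => X Y _ _ XY; apply/seteqP; split=> // Z [].
  rewrite !qball_miota => -[B -> BX] [B' /miota_inj <- BY].
  move/eqP: XY; apply; apply: congm_liftm; apply/truncm_eq.
  by move/truncm_eq: BX => <-; apply/truncm_eq.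
- by move=> X; apply: measurable_qball.
- by rewrite filter_uniq ?index_enum_uniq.
under eq_bigr => X _ do rewrite vol_qball.
rewrite big_filter.
rewrite natr_sum -sumEFin ge0_sume_distrl => [|X _]; last by rewrite lee_fin.
rewrite big_mkcond; apply: eq_bigr => X _.
by case: (f _); rewrite ?mul1e ?mul0e.
Qed.

(** p^(-M) Mat(N, Z_p) splits mod p^M into b^(M N^2) translates of Mat(N, Z_p), each of volume 1,
    and mod p^n into b^(n N^2) balls of the wanted radius. *)
Lemma vol_qball0 M n :
  vol (qball (miota M 0) (n%:Z - M%:Z)) = ((b%:R ^+ (M * (N * N))) / (b%:R ^+ (n * (N * N))))%:E.
Proof.
have full K m : vol (miotaset K xpredT) =
   ((b ^ (m * (N * N)))%N%:R%:E * vol (qball (miota K 0) (m%:Z - K%:Z)))%E.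
  rewrite (@vol_miotaset_ball K m) //; congr (_%:R%:E * _)%E.
  by rewrite sum_nat_const card_ordmx muln1.
have MatZpE : @MatZp p N = qball (miota 0 0) 0.
  rewrite -[X in qball _ X](subrr 0%N%:Z) qball_miota; apply/seteqP.
  split=> [Z /mintP[A ->]|Z [A -> _]]; last by apply/mintP; exists A.
  by exists A => //; exists A; rewrite expr0 scale1r add0r.
have ballM : qball (miota M 0) (M%:Z - M%:Z) = qball (miota 0 0) 0.
  rewrite subrr; congr qball; apply/matrixP => i j; rewrite !mxE.
  by rewrite -!qzero_piota.
have := full M M; rewrite ballM -MatZpE vol_norm mule1 (full M n) => E.
have q0 : (b%:R ^+ (n * (N * N)) : R) != 0 by rewrite expf_neq0 // pnatr_eq0 -lt0n base_gt0.
(* An infinite volume is excluded because the total b^(M N^2) is finite. *)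
move: E; rewrite !natrX; case: (vol _) => [v| |] /=.
- by rewrite -EFinM => -[E]; congr EFin; rewrite -E mulrAC mulfV // mul1r.
- by rewrite gt0_muley // lte_fin exprn_gt0 // ltr0n base_gt0.
- by rewrite gt0_muleNy // lte_fin exprn_gt0 // ltr0n base_gt0.
Qed.

Lemma vol_miotaset M n f : cong_inv n f ->
  vol (miotaset M f) =
  ((\sum_(X : 'M['I_(b ^ n)]_N) f (liftm X))%:R *
   (b%:R ^+ (M * (N * N)) / b%:R ^+ (n * (N * N))))%:E.
Proof. by move=> fi; rewrite (vol_miotaset_ball _ fi) vol_qball0 EFinM. Qed.

Hypothesis hp : prime p.

Lemma vol_divprofile M n t : t 0%N = N ->
  vol (miotaset M (divprofile hp n t)) =
  (p%:R ^+ (M * (N * N)) * \prod_(i < n) Pker p 0 (t i) (t i.+1))%:E.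
Proof.
move=> t0; rewrite (vol_miotaset _ (@divprofile_inv _ hp n N t)).
rewrite -/(nprofile hp n N t) (nprofileE hp R n t0) base_prime //; congr EFin.
have p0 : (p%:R ^+ (n * (N * N)) : R) != 0.
  by rewrite expf_neq0 // pnatr_eq0 -lt0n prime_gt0.
by field.
Qed.

End Volume.

(** * q-series identities *)

Section Algebra.
Variables (R : realType) (p : nat) (hp : prime p).
Local Notation t := (Defs.pinv R p).

Lemma pinv_itv : 0 < t < 1.
Proof.
have p0 : 0 < p%:R :> R by rewrite ltr0n prime_gt0.
by rewrite invr_gt0 p0 invf_lt1 // ltr1n prime_gt1.
Qed.

Lemma pa_itv (s : R) : -1 < s -> 0 < pa p s < 1.
Proof.
move=> s1; rewrite powR_gt0 ?ltr0n ?prime_gt0 //=.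
have s1' : 0 < 1 + s by rewrite -ltrBlDl sub0r.
rewrite /pa -opprD powRN invf_lt1 ?powR_gt0 ?ltr0n ?prime_gt0 //.
have := @gt0_ltr_powR _ _ s1' 1 p%:R; rewrite powR1; apply.
- by rewrite nnegrE ler01.
- by rewrite nnegrE ler0n.
- by rewrite ltr1n prime_gt1.
Qed.

Lemma qpoch_pinv_neq0 n : qpoch t t n != 0.
Proof. by case/andP: pinv_itv => t0 t1; rewrite gt_eqF // qpoch_gt0 // t0 t1. Qed.

Lemma qpochSl (a q : R) n : qpoch a q n.+1 = (1 - a) * qpoch (a * q) q n.
Proof.
rewrite /qpoch big_ord_recl expr0 mulr1; congr (_ * _).
by apply: eq_bigr => i _; rewrite /= /bump /= add1n exprS mulrA.
Qed.

(** Induction on n through 1 - t^(n+1) = (1 - t^x) + t^x (1 - t^(n+1-x)): each part cancels the last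
    factor of one Pochhammer symbol. The first part, shifted by one, is the sum for (n, m, a t); the
    second is the sum for (n, m + 1, a), m + 1 being the upper size in the goal. *)
Lemma qvandermonde (a : R) n m : 0 < a < 1 -> (n <= m)%N ->
  \sum_(x < n.+1) t ^+ ((n - x) * (m - x)) /
     (qpoch t t x * qpoch a t x * qpoch t t (n - x) * qpoch t t (m - x)) =
  qpoch a t (n + m) / (qpoch a t n * qpoch a t m * qpoch t t n * qpoch t t m).
Proof.
have /andP[t0 t1] := pinv_itv.
have an0 c k : 0 < c < 1 -> qpoch c t k != 0.
  by move=> /andP[c0 c1]; rewrite gt_eqF // qpoch_gt0 // t0 t1.
elim: n m a => [|n IH] [|m] a a01 // nm.
- by rewrite big_ord1 !qpoch0 !mulr1 expr0.
- rewrite big_ord1 /= !qpoch0 !subn0 mul0n expr0 add0n.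
  by field; rewrite qpoch_pinv_neq0 an0.
have at01 : 0 < a * t < 1.
  by case/andP: a01 => a0 a1; rewrite mulr_gt0 //= mulr_ilt1 // ltW.
have tS0 : 1 - t ^+ n.+1 != 0.
  by rewrite subr_eq0 eq_sym lt_eqF // exprn_ilt1 // ltW.
have a1n0 : 1 - a != 0 by rewrite subr_eq0 eq_sym lt_eqF //; case/andP: a01.
apply: (mulfI tS0).
have IH1 := IH m (a * t) at01 nm.
have IH2 := IH m.+1 a a01 (leqW nm).
transitivity ((1 - a)^-1 * (qpoch (a * t) t (n + m) /
   (qpoch (a * t) t n * qpoch (a * t) t m * qpoch t t n * qpoch t t m)) +
   t ^+ m.+1 * (qpoch a t (n + m.+1) /
   (qpoch a t n * qpoch a t m.+1 * qpoch t t n * qpoch t t m.+1))).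
  rewrite -IH1 -IH2 !mulr_sumr.
  pose u x := t ^+ ((n.+1 - x) * (m.+1 - x)) /
     (qpoch t t x * qpoch a t x * qpoch t t (n.+1 - x) * qpoch t t (m.+1 - x)).
  transitivity (\sum_(x < n.+2) (1 - t ^+ x) * u x +
                \sum_(x < n.+2) t ^+ x * (1 - t ^+ (n.+1 - x)) * u x).
    rewrite -big_split /=; apply: eq_bigr => x _; rewrite -/(u x) -mulrDl.
    by rewrite mulrBr mulr1 -exprD subnKC ?addrA ?subrK // -ltnS.
  congr (_ + _).
    rewrite big_ord_recl expr0 subrr mul0r add0r; apply: eq_bigr => x _.
    rewrite /u /= /bump /= add1n !subSS (qpochS t t x) (qpochSl a) -exprS.
    have tx : 1 - t ^+ x.+1 != 0.
      by rewrite subr_eq0 eq_sym lt_eqF // exprn_ilt1 // ltW.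
    by field; rewrite !qpoch_pinv_neq0 tx a1n0 an0.
  rewrite big_ord_recr /= subnn expr0 subrr mulr0 mul0r addr0.
  apply: eq_bigr => x _; rewrite /u.
  have xn : (x <= n)%N by rewrite -ltnS.
  rewrite subSn // (qpochS t t (n - x)) -exprS.
  have tx : 1 - t ^+ (n - x).+1 != 0.
    by rewrite subr_eq0 eq_sym lt_eqF // exprn_ilt1 // ltW.
  have -> : t ^+ m.+1 = t ^+ x * t ^+ (m.+1 - x).
    by rewrite -exprD subnKC // ltnW // ltnS (leq_trans xn).
  rewrite mulSn exprD.
  by field; rewrite !qpoch_pinv_neq0 tx an0.
have e1 : qpoch a t n.+1 = (1 - a) * qpoch (a * t) t n := qpochSl _ _ _.
have e2 : qpoch a t m.+1 = (1 - a) * qpoch (a * t) t m := qpochSl _ _ _.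
have e3 : qpoch a t n.+1 = qpoch a t n * (1 - a * t ^+ n) := qpochS _ _ _.
have e4 : qpoch a t (n + m.+1) = (1 - a) * qpoch (a * t) t (n + m).
  by rewrite addnS qpochSl.
have e5 : qpoch a t (n.+1 + m.+1) =
    (1 - a) * qpoch (a * t) t (n + m) * (1 - a * t ^+ n * t ^+ m.+1).
  by rewrite addSn qpochS e4 -[a * _ * _]mulrA -exprD.
have xn0 : 1 - a * t ^+ n != 0.
  have := an0 a n.+1 a01; rewrite e3 mulf_eq0 negb_or => /andP[]//.
have e6 : qpoch (a * t) t n = qpoch a t n * (1 - a * t ^+ n) / (1 - a).
  by apply: (mulfI a1n0); rewrite -e1 e3 mulrCA mulfV // mulr1.
rewrite e5 e4 e3 e2 e6 (qpochS t t n) (qpochS t t m) -!exprS.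
have tm : 1 - t ^+ m.+1 != 0.
  by rewrite subr_eq0 eq_sym lt_eqF // exprn_ilt1 // ltW.
by field; rewrite !qpoch_pinv_neq0 tm tS0 a1n0 xn0 !an0.
Qed.

Lemma pitilde_ge0 N (s : R) x : -1 < s -> 0 <= pitilde p N s x.
Proof.
move=> /pa_itv/andP[a0 a1]; have /andP[t0 t1] := pinv_itv.
have ap k : 0 <= qpoch (pa p s) t k by apply/ltW/qpoch_gt0; rewrite ?t0 ?t1.
have tp k : 0 <= qpoch t t k by apply/ltW/qpoch_gt0; rewrite ?t0 ?t1.
by rewrite /pitilde !(mulr_ge0, invr_ge0, exprn_ge0) // ltW.
Qed.

Lemma pitilde_sum N (s : R) : -1 < s -> \sum_(x < N.+1) pitilde p N s x = 1.
Proof.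
move=> s1; have a01 := pa_itv s1; have /andP[t0 t1] := pinv_itv.
have an0 k : qpoch (pa p s) t k != 0.
  by case/andP: a01 => a0 a1; rewrite gt_eqF // qpoch_gt0 // t0 t1.
have := qvandermonde a01 (leqnn N); rewrite addnn -mul2n => V.
pose C := qpoch (pa p s) t N ^+ 2 * qpoch t t N ^+ 2 / qpoch (pa p s) t (2 * N)%N.
transitivity (C * (qpoch (pa p s) t (2 * N) /
  (qpoch (pa p s) t N * qpoch (pa p s) t N * qpoch t t N * qpoch t t N))).
  rewrite -V mulr_sumr; apply: eq_bigr => x _; rewrite /pitilde /C mulnn.
  by field; rewrite !qpoch_pinv_neq0 !an0.
by rewrite /C; field; rewrite !qpoch_pinv_neq0 !an0.
Qed.

(* Detailed-balance weight relating the chain [Pker p s] to the time reversal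
   of [Pker p 0] under [x |-> N - x]. *)
Definition revwt N (s : R) x : R :=
  qpoch t t x * qpoch (pa p s) t x * qpoch t t (N - x) ^+ 2 * p%:R ^+ ((N - x) ^ 2).

Lemma pa0 : pa p 0 = t.
Proof. by rewrite /pa subr0 powR_inv1 // ler0n. Qed.

(** The exponent s + 2N is what makes the dependence on y cancel: -y^2 - s y + (N - y)^2 + (s + 2N)
    y = N^2. *)
Lemma Pker_reverse N (s : R) x y : -1 < s -> (y <= x)%N -> (x <= N)%N ->
  Pker p s x y * (revwt N s y * p%:R `^ ((s + 2 * N%:R) * y%:R)) =
  Pker p 0 (N - y) (N - x) * (revwt N s x * p%:R ^+ (N ^ 2)).
Proof.
move=> s1 yx xN; have /andP[a0 a1] := pa_itv s1; have /andP[t0 t1] := pinv_itv.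
have an0 k : qpoch (pa p s) t k != 0 by rewrite gt_eqF // qpoch_gt0 // t0 t1.
have p0 : (p%:R : R) != 0 by rewrite pnatr_eq0 -lt0n prime_gt0.
rewrite /Pker yx leq_sub2l // pa0 /revwt mul0r subr0.
have -> : (N - y - (N - x) = x - y)%N by lia.
have e1 : p%:R `^ (- (N - x)%:R ^+ 2) * p%:R ^+ ((N - x) ^ 2) = 1 :> R.
  by rewrite -(@powR_mulrn _ p%:R) ?ler0n // -powRD ?p0 ?implybT // natrX addNr powRr0.
have e2 : p%:R `^ (- (y%:R ^+ 2) - s * y%:R) * p%:R ^+ ((N - y) ^ 2) *
          p%:R `^ ((s + 2 * N%:R) * y%:R) = p%:R ^+ (N ^ 2) :> R.
  rewrite -!(@powR_mulrn _ p%:R) ?ler0n // -!powRD ?p0 ?implybT //; congr (_ `^ _).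
  rewrite !natrX natrB ?(leq_trans yx) //; ring.
transitivity ((p%:R `^ (- (y%:R ^+ 2) - s * y%:R) * p%:R ^+ ((N - y) ^ 2) *
          p%:R `^ ((s + 2 * N%:R) * y%:R)) *
   (qpoch t t x * qpoch (pa p s) t x * qpoch t t (N - y) ^+ 2 / qpoch t t (x - y))).
  by field; rewrite !qpoch_pinv_neq0 an0.
rewrite e2.
transitivity ((p%:R `^ (- (N - x)%:R ^+ 2) * p%:R ^+ ((N - x) ^ 2)) * (p%:R ^+ (N ^ 2) *
   (qpoch t t x * qpoch (pa p s) t x * qpoch t t (N - y) ^+ 2 / qpoch t t (x - y)))).
  by rewrite e1 mul1r.
by field; rewrite !qpoch_pinv_neq0.
Qed.

(** Detailed balance multiplied along a path: the weights telescope, and the x_(i+1) add up to what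
    will be the exponent of p in gamma. *)
Lemma Pker_prod_reverse N (s : R) K (x : nat -> nat) : -1 < s ->
  (forall i, (x i.+1 <= x i)%N) -> (x 0 <= N)%N ->
  \prod_(i < K) Pker p s (x i) (x i.+1) *
    (revwt N s (x K) * p%:R `^ ((s + 2 * N%:R) * (\sum_(i < K) x i.+1)%:R)) =
  \prod_(i < K) Pker p 0 (N - x i.+1) (N - x i) * (revwt N s (x 0) * p%:R ^+ (K * N ^ 2)).
Proof.
move=> s1 xd x0; have p0 : (p%:R : R) != 0 by rewrite pnatr_eq0 -lt0n prime_gt0.
have xN i : (x i <= N)%N by elim: i => // i; apply: leq_trans.
elim: K => [|K IH]; first by rewrite !big_ord0 mulr0 powRr0 mul0n expr0.
rewrite !big_ord_recr /= natrD mulrDr powRD ?p0 ?implybT // mulSn exprD.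
set S := p%:R `^ (_ * (\sum_(i < K) _)%:R) in IH *.
transitivity (\prod_(i < K) Pker p s (x i) (x i.+1) * S *
  (Pker p s (x K) (x K.+1) * (revwt N s (x K.+1) * p%:R `^ ((s + 2 * N%:R) * (x K.+1)%:R)))).
  by ring.
rewrite Pker_reverse //.
transitivity ((\prod_(i < K) Pker p s (x i) (x i.+1) * (revwt N s (x K) * S)) *
  (Pker p 0 (N - x K.+1) (N - x K) * p%:R ^+ (N ^ 2))); first by ring.
by rewrite IH; ring.
Qed.

(** [pitilde] is [Mconst] times (t;t)_N^2 / [revwt], which cancels the weight at the start of the
    path. At its end x = 0 the weight is (t;t)_N^2 p^(N^2), which absorbs one of the K + 1 powers
    p^(N^2); for K = M the rest is the volume of p^(-M) Mat(N, Z_p). *)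
Lemma pitilde_prod N (s : R) K (x : nat -> nat) : -1 < s ->
  (forall i, (x i.+1 <= x i)%N) -> (x 0 <= N)%N -> x K.+1 = 0%N ->
  pitilde p N s (x 0) * \prod_(i < K.+1) Pker p s (x i) (x i.+1) =
  Mconst p N s * p%:R `^ ((- s - 2 * N%:R) * (\sum_(i < K.+1) x i.+1)%:R) *
  (p%:R ^+ (K * N ^ 2) * \prod_(i < K.+1) Pker p 0 (N - x i.+1) (N - x i)).
Proof.
move=> s1 xd x0 xK; have := Pker_prod_reverse K.+1 s1 xd x0.
have /andP[a0 a1] := pa_itv s1; have /andP[t0 t1] := pinv_itv.
have an0 k : qpoch (pa p s) t k != 0 by rewrite gt_eqF // qpoch_gt0 // t0 t1.
have p0 : (p%:R : R) != 0 by rewrite pnatr_eq0 -lt0n prime_gt0.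
rewrite xK {1}/revwt !qpoch0 subn0 !mul1r mulSn exprD.
have -> : (- s - 2 * N%:R) * (\sum_(i < K.+1) x i.+1)%:R =
          - ((s + 2 * N%:R) * (\sum_(i < K.+1) x i.+1)%:R) :> R by ring.
rewrite powRN; set S := p%:R `^ _.
have S0 : S != 0 by rewrite gt_eqF // powR_gt0 // ltr0n prime_gt0.
set P := \prod_(i < K.+1) _; set Q := \prod_(i < K.+1) _ => E.
have {}E : P = Q * revwt N s (x 0) * p%:R ^+ (K * N ^ 2) / (qpoch t t N ^+ 2 * S).
  apply: (mulIf (mulf_neq0 (mulf_neq0 (expf_neq0 2 (qpoch_pinv_neq0 N)) S0)
                     (expf_neq0 (N ^ 2) p0))).
  transitivity (P * (qpoch t t N ^+ 2 * p%:R ^+ (N ^ 2) * S)); first by ring.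
  by rewrite E; field; rewrite S0 qpoch_pinv_neq0.
rewrite E /pitilde /Mconst /revwt.
have -> : t ^+ ((N - x 0) ^ 2) = (p%:R ^+ ((N - x 0) ^ 2))^-1 by rewrite -exprVn.
by field; rewrite S0 !qpoch_pinv_neq0 !an0 expf_neq0.
Qed.

End Algebra.

(** * The law of Sing *)

Lemma sum_ltn_ord K m : (\sum_(i < K) (i < m) = minn K m)%N.
Proof.
elim: K => [|K IH]; first by rewrite big_ord0 min0n.
by rewrite big_ord_recr /= IH; case: ltnP; lia.
Qed.

Section SingLaw.
Variables (R : realType) (p : nat) (hp : prime p) (N : nat).

Section Indices.
Variables (M : nat) (k : 'I_N -> option int).
Hypothesis kM : singbnd M k.

Lemma ngeo_singexp c : ngeo (singexp M k) c =
  (N - \sum_(j < N) (if k j is Some m then nat_of_bool (M%:Z + 1 - c%:Z <= m)%R else 0))%N.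
Proof.
have E : (ngeo (singexp M k) c + \sum_(j < N)
    (if k j is Some m then nat_of_bool (M%:Z + 1 - c%:Z <= m)%R else 0) = N)%N.
  rewrite /ngeo -big_split /= -[RHS]card_ord -sum1_card.
  apply: eq_big => // j _; rewrite /singexp; case kj : (k j) => [m|] //=.
  by have := kM kj; lia.
by rewrite -[X in (X - _)%N]E addnK.
Qed.

(** Level M + 1 - i carries N - x_i, in reversed order; at i = 0 it meets the second chain, as N -
    x_0 = y_0. *)
Lemma ngeo_singexp_xs i : (i <= M.+1)%N -> ngeo (singexp M k) (M.+1 - i) = (N - xs k i)%N.
Proof.
move=> iM; rewrite ngeo_singexp /xs; congr (_ - _)%N; apply: eq_bigr => j _.
by case: (k j) => // m; have -> : M%:Z + 1 - (M.+1 - i)%N%:Z = i%:Z by lia.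
Qed.

Lemma ngeo_singexp_ys i : ngeo (singexp M k) (M.+1 + i) = ys k i.
Proof.
rewrite ngeo_singexp /ys; congr (_ - _)%N; apply: eq_bigr => j _.
by case: (k j) => // m; have -> : M%:Z + 1 - (M.+1 + i)%N%:Z = - i%:Z by lia.
Qed.

Lemma xs_anti i : (xs k i.+1 <= xs k i)%N.
Proof. by apply: leq_sum => j _; case: (k j) => // m; lia. Qed.

Lemma xs_le i : (xs k i <= N)%N.
Proof.
rewrite -[X in (_ <= X)%N]card_ord -sum1_card; apply: leq_sum => j _.
by case: (k j) => // m; apply: leq_b1.
Qed.

Lemma xs_eq0 i : (M < i)%N -> xs k i = 0%N.
Proof.
move=> Mi; rewrite /xs big1 // => j _; case kj : (k j) => [m|] //.
by have := kM kj; lia.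
Qed.

(** A positive k_j is counted once for each i with 1 <= i <= k_j, so the x_i with i >= 1 add up to
    the sum of the positive k_j; the range is long enough because k_j <= M. *)
Lemma gammakE : gammak R p k = p%:R ^+ (\sum_(i < M.+1) xs k i.+1).
Proof.
rewrite /xs exchange_big /= -prodrXr; apply: eq_bigr => j _.
case kj : (k j) => [m|]; last by rewrite big1.
case: ifP => m0; last by rewrite big1 // => i _; apply/eqP; rewrite eqb0; lia.
congr (_ ^+ _); rewrite (eq_bigr (fun i : 'I_M.+1 => nat_of_bool (i < absz m)%N)).
  by rewrite sum_ltn_ord; have := kM kj; lia.
by move=> i _; lia.
Qed.

End Indices.

Variable vol : {measure set (MatQpMeas p N) -> \bar R}.
Hypothesis vol_inv : forall (A : MatQp p N) (S : set (MatQpMeas p N)),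
  measurable S -> vol (mtranslate A @` S) = vol S.
Hypothesis vol_norm : vol (@MatZp p N) = 1%E.

Variables (M : nat) (k : 'I_N -> option int).
Hypothesis kd : inDelta k.
Hypothesis kM : singbnd M k.

Let t := ngeo (singexp M k).
Let F n : set (MatQpMeas p N) := miotaset M (divprofile hp n t).
Let E : set (MatQpMeas p N) := [set Z | Sing Z = k].

(** An entry -oo cannot be recognised at any finite level, so {Sing = k} is reached only as an
    intersection. *)
Lemma Sing_bigcap : E = \bigcap_n F n.
Proof.
apply/seteqP; split=> [Z /(SingP hp Z kd kM)[A ZA Ak] n _|Z hZ].
  by exists A => //; apply/divprofileP => c _; rewrite Ak.
apply/(SingP hp Z kd kM); have [A ZA _] := hZ 0%N I; exists A => // c.
(* Each level supplies its own integral matrix; all coincide because [miota M] is injective. *)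
have [A' + /divprofileP/(_ c (leqnn c))] := hZ c I.
by rewrite ZA => /miota_inj <-.
Qed.

Lemma measurable_Sing : measurable E.
Proof.
rewrite Sing_bigcap; apply: bigcap_measurableType => n _.
by apply: (@measurable_miotaset p N M n); apply: divprofile_inv.
Qed.

Let v n : R := p%:R ^+ (M * (N * N)) * \prod_(i < n) Pker p 0 (t i) (t i.+1).

Lemma vol_Sing_cvg : exists2 l : R, vol E = l%:E & v @ \oo --> l.
Proof.
have t0 : t 0%N = N by exact: ngeo0.
have vF n : vol (F n) = (v n)%:E by exact: vol_divprofile.
have mF n : measurable (F n) by apply: (@measurable_miotaset p N M n); apply: divprofile_inv.
have mE := measurable_Sing.
(* [E] lies in [F 0], whose volume p^(M N^2) is finite; this also starts the continuity from
   above. *)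
have fE : vol E \is a fin_num.
  rewrite ge0_fin_numE ?measure_ge0 //; apply: (@le_lt_trans _ _ (vol (F 0%N))).
    apply: le_measure; rewrite ?inE //.
    by rewrite Sing_bigcap; apply: bigcap_inf.
  by rewrite vF ltry.
exists (fine (vol E)); first by rewrite fineK.
have : vol \o F @ \oo --> vol (\bigcap_n F n).
  apply: nonincreasing_cvg_mu => //; first by rewrite vF ltry.
    by rewrite -Sing_bigcap.
  move=> m n mn; apply/subsetPset => Z [A ZA /divprofileP h]; exists A => //.
  by apply/divprofileP => c cm; apply: h; apply: leq_trans mn.
rewrite -Sing_bigcap -(fineK fE) => /fine_cvg.
apply: cvg_trans; apply: near_eq_cvg; apply: nearW => n /=.
by rewrite vF.
Qed.

Lemma mN_Sing (s l : R) : vol E = l%:E ->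
  mN vol s k = (Mconst p N s * (gammak R p k `^ (- s - 2 * N%:R) * l))%:E.
Proof.
move=> El; rewrite /mN /MN.
rewrite (@eq_integral _ _ _ _ _ (cst ((gammak R p k `^ (- s - 2 * N%:R))%:E))); last first.
  by move=> Z; rewrite inE => <-.
by rewrite integral_cst; [rewrite El -!EFinM | exact: measurable_Sing].
Qed.

(** An exact identity of finite products: of the n + M + 1 steps of the P^(0) chain, the first M + 1
    are reversed into the x_i and the other n are the steps of the y_i. *)
Lemma chain_prod (s : R) n : -1 < s -> (M < n)%N ->
  pitilde p N s (xs k 0) * (\prod_(i < n) Pker p s (xs k i) (xs k i.+1)) *
    (\prod_(i < n) Pker p 0 (ys k i) (ys k i.+1)) =
  Mconst p N s * (gammak R p k `^ (- s - 2 * N%:R) * v (n + M.+1)).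
Proof.
move=> s1 Mn.
(* From x_(M+1) = 0 on, the first chain stays at 0, and P^(s)(0, 0) = 1. *)
have -> : \prod_(i < n) Pker p s (xs k i) (xs k i.+1) =
          \prod_(i < M.+1) Pker p s (xs k i) (xs k i.+1).
  rewrite -(subnKC Mn) big_split_ord /= [X in _ * X]big1 ?mulr1 // => i _.
  rewrite !(xs_eq0 kM) /Pker ?leqnn /=; try lia.
  by rewrite !qpoch0 !mulr1 expr0n /= mulr0 subr0 oppr0 powRr0 divr1.
rewrite (@pitilde_prod R p hp N s M (xs k)) //; first last.
- exact: (xs_eq0 kM).
- exact: xs_le.
- exact: xs_anti.
rewrite (gammakE kM) -[p%:R ^+ (\sum_(i < _) _)]powR_mulrn ?ler0n // -powRrM.
rewrite [_%:R * (- s - _)]mulrC -!mulrA; do 4! congr (_ * _).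
rewrite /v mulnn; congr (_ * _).
rewrite addnC big_split_ord /=; congr (_ * _); last first.
  apply: eq_bigr => i _; rewrite -!(ngeo_singexp_ys kM) /t.
  by rewrite addnS.
(* The time reversal i -> M - i of the first M + 1 levels. *)
rewrite [RHS](reindex_inj rev_ord_inj) /=; apply: eq_bigr => i _.
have iM := ltn_ord i.
by rewrite -!(ngeo_singexp_xs kM) /t ?(ltnW iM) //; congr Pker; rewrite ?subnSK.
Qed.

Lemma chain_cvg (s l : R) : -1 < s -> v @ \oo --> l ->
  (fun n => pitilde p N s (xs k 0) * (\prod_(i < n) Pker p s (xs k i) (xs k i.+1)) *
    (\prod_(i < n) Pker p 0 (ys k i) (ys k i.+1))) @ \oo -->
  Mconst p N s * (gammak R p k `^ (- s - 2 * N%:R) * l).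
Proof.
move=> s1 vl; pose w n := Mconst p N s * (gammak R p k `^ (- s - 2 * N%:R) * v (n + M.+1)).
have wl : w @ \oo --> Mconst p N s * (gammak R p k `^ (- s - 2 * N%:R) * l).
  apply: cvgM; first exact: cvg_cst.
  by apply: cvgM; [exact: cvg_cst | rewrite (cvg_shiftn M.+1 v)].
apply: cvg_trans wl; apply: near_eq_cvg; exists M.+1 => //= n Mn.
by apply/esym; exact: chain_prod.
Qed.

End SingLaw.

Theorem theorem3p4 (R : realType) (p : nat) (hp : prime p) (N : nat)
  (s : R) (hs : -1 < s)
  (vol : {measure set (MatQpMeas p N) -> \bar R})
  (vol_inv : forall (A : MatQp p N) (S : set (MatQpMeas p N)),
      measurable S -> vol (mtranslate A @` S) = vol S)
  (vol_norm : vol (@MatZp p N) = 1%E) :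
  ((forall x : nat, (x <= N)%N -> 0 <= pitilde p N s x)
   /\ \sum_(x < N.+1) pitilde p N s x = 1)
  /\
  (forall k : 'I_N -> option int, inDelta k ->
     exists L : R,
       ((fun n : nat =>
           pitilde p N s (xs k 0)
           * (\prod_(i < n) Pker p s (xs k i) (xs k i.+1))
           * (\prod_(i < n) Pker p 0 (ys k i) (ys k i.+1))) @ \oo --> L)
       /\ mN vol s k = L%:E).
Proof.
split; first by split=> [x _|]; [apply: pitilde_ge0 | apply: pitilde_sum].
move=> k kd; have [M kM] := singbnd_ex k.
have [l El vl] := @vol_Sing_cvg R p hp N vol vol_inv vol_norm M k kd kM.
(* The limit is fixed as the value of the mass; convergence to it is proved afterwards. *)
eexists; split; last exact: (@mN_Sing R p hp N vol M k kd kM s l El).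
exact: (@chain_cvg R p hp N M k kM s l hs vl).
Qed.
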